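(* For integers $k\ge2$, \[ \alpha_k=k^{\frac{\log k}{2}+O(1)}\quad\text{and}\quad\beta_k=k^{2\log2+O\left(\frac{1}{\log k}\right)}. \]
   Context: $\log$ is the natural logarithm. With $\vec b_i^*$ the Gram–Schmidt vectors ($\vec b_i^*=\vec b_i-\sum_{j<i}\mu_{i,j}\vec b_j^*$, $\mu_{i,j}=\langle\vec b_i,\vec b_j^*\rangle/\|\vec b_j^*\|^2$), Schnorr's constants are \[ \alpha_k=\max_{(\vec b_i)_{i\le k}\text{ HKZ-reduced}}\frac{\|\vec b_1\|^2}{\|\vec b_k^*\|^2},\qquad \beta_k=\max_{(\vec b_i)_{i\le 2k}\text{ HKZ-reduced}}\left(\frac{\prod_{i\le k}\|\vec b_i^*\|^2}{\prod_{i>k}\|\vec b_i^*\|^2}\right)^{1/k}, \] maxima over HKZ-reduced bases of $k$-dimensional, respectively $2k$-dimensional, lattices. A basis is HKZ-reduced if its first vector is a shortest nonzero lattice vector and recursively the projection of the remaining vectors orthogonally to the first is HKZ-reduced. *)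

(* Defs.v *)
From HB Require Import structures.
From mathcomp Require Import all_boot all_order all_algebra.
From mathcomp Require Import all_classical all_reals all_analysis.
Set Implicit Arguments.
Unset Strict Implicit.
Unset Printing Implicit Defensive.
Import Order.TTheory GRing.Theory Num.Theory.
Local Open Scope classical_set_scope.
Local Open Scope ring_scope.

Section Lattices.
Variables (R : realType) (n : nat).
Implicit Types (u v c : 'rV[R]_n) (b s : seq 'rV[R]_n).

Definition dotv u v : R := \sum_(i < n) u 0 i * v 0 i.

(* The norm `|u| that the library puts on matrices is the sup norm. *)
Definition enorm u : R := Num.sqrt (dotv u u).

(* The coefficient of the orthogonal projection of u on the line spanned by c;
   mu_(i,j) is [proj_coef b_i b_j^*]. *)
Definition proj_coef u c : R := dotv u c / enorm c ^+ 2.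

Definition gso b : seq 'rV[R]_n :=
  foldl (fun g u => rcons g (u - \sum_(c <- g) proj_coef u c *: c)) [::] b.

Definition lattice b : set 'rV[R]_n :=
  [set v | exists z : nat -> int, v = \sum_(i < size b) (z i)%:~R *: b`_i].

Definition shortest_nonzero (L : set 'rV[R]_n) v : Prop :=
  [/\ L v, v != 0 & forall u, L u -> u != 0 -> enorm v <= enorm u].

Inductive HKZ : seq 'rV[R]_n -> Prop :=
| HKZ_nil : HKZ [::]
| HKZ_cons u s :
    shortest_nonzero (lattice (u :: s)) u ->
    HKZ [seq v - proj_coef v u *: u | v <- s] ->
    HKZ (u :: s).

Definition HKZ_reduced_basis (k : nat) b : Prop :=
  [/\ size b = k, free b & HKZ b].

Lemma size_gso b : size (gso b) = size b.
Proof.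
elim/last_ind: b => // b u IH.
by rewrite /gso foldl_rcons -/(gso b) !size_rcons IH.
Qed.

(* The defining recursion of the Gram-Schmidt vectors, indices from 0. *)
Lemma gsoE b i : (i < size b)%N ->
  (gso b)`_i =
  b`_i - \sum_(j < i) proj_coef b`_i (gso b)`_j *: (gso b)`_j.
Proof.
elim/last_ind: b => // b u IH; rewrite size_rcons ltnS => le_ib.
rewrite {1 2 3}/gso foldl_rcons -/(gso b) !nth_rcons size_gso.
have [lt_ib|] := ltnP i (size b).
  rewrite {1}IH //; congr (_ - _); apply: eq_bigr => j _.
  by rewrite nth_rcons size_gso (ltn_trans (ltn_ord j)).
move=> le_bi; have -> : i = size b by apply/eqP; rewrite eqn_leq le_ib.
rewrite eqxx (big_nth 0) size_gso big_mkord; congr (_ - _).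
by apply: eq_bigr => j _; rewrite nth_rcons size_gso ltn_ord.
Qed.

End Lattices.

Section SchnorrConstants.
Variable R : realType.

(* The greatest element of A; the default value 0 is returned only when A has
   no greatest element. *)
Definition maximum (A : set R) : R := xget 0 (A `&` ubound A).

(* A k-dimensional lattice may lie in a Euclidean space of any dimension n.
   Vectors are numbered from 0, so b_i and b_i^* are b`_(i - 1) and
   (gso b)`_(i - 1). *)
Definition schnorr_alpha (k : nat) : R :=
  maximum [set x | exists (n : nat) (b : seq 'rV[R]_n),
    HKZ_reduced_basis k b /\
    x = enorm b`_0 ^+ 2 / enorm (gso b)`_k.-1 ^+ 2].

Definition schnorr_beta (k : nat) : R :=
  maximum [set x | exists (n : nat) (b : seq 'rV[R]_n),
    HKZ_reduced_basis (2 * k)%N b /\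
    x = ((\prod_(0 <= i < k) enorm (gso b)`_i ^+ 2) /
         (\prod_(k <= i < (2 * k)%N) enorm (gso b)`_i ^+ 2)) `^ k%:R^-1].

End SchnorrConstants.

(* Main.v *)
Require Import Defs.
From mathcomp Require Import all_boot all_order all_algebra.
From mathcomp Require Import all_classical all_reals all_analysis.
From mathcomp Require Import zify ring lra.
Import Order.TTheory GRing.Theory Num.Theory.
Set Implicit Arguments.
Unset Strict Implicit.
Unset Printing Implicit Defensive.
Local Open Scope ring_scope.

(* For a basis with Gram-Schmidt norms x_0, x_1, ... numbered from the last
   vector to the first, HKZ-reduction says that x_l is the minimum of the
   lattice of dimension l + 1 spanned by the projections of the last l + 1
   vectors.

   Upper bounds: Minkowski's inequality bounds x_l by sqrt (l + 1) times the
   geometric mean of x_0, ..., x_l; the means A_d of the first d logarithms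
   thus satisfy A_(d+1) - A_d <= ln (d + 1) / (2 d), and both constants are
   expressed by differences of such means (ln beta_k = 4 (A_2k - A_k)).

   Lower bounds: add the Gram-Schmidt vectors one at a time, from the last one
   to the first, and control the Epstein sum of |v| ^ -(d + 1) over the nonzero
   vectors v of the current lattice, of dimension d. When the new vector has norm
   x and the lifts are chosen uniformly, the mean of the sum of |w| ^ -(d + 2)
   over the w with a nonzero projection is O(1 / (x sqrt d)) times the old sum.
   Some lift does at least as well as the mean, and if x ^ (d + 2) times that
   mean is less than 1 no such w is shorter than x. This permits
   (x_new / x_old) ^ (d + 1) to be of order sqrt d, the order of growth in
   Minkowski's bound. All sums are restricted to a box of coefficients, large
   enough to contain all short vectors, and the lifts are taken in a line of a
   finite torus.

   The maxima are attained by compactness: a size-reduced basis whose first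
   vector has norm 1 and for which the ratio to maximize is at least 1 has
   bounded coordinates. *)

(** * Gram-Schmidt vectors and triangular coordinates *)

Section GramSchmidt.
Variables (R : realType) (n : nat).
Implicit Types (u v w c : 'rV[R]_n) (b s : seq 'rV[R]_n).

Lemma dotvC u v : dotv u v = dotv v u.
Proof. by apply: eq_bigr => i _; rewrite mulrC. Qed.

Lemma dotvDl u v w : dotv (u + v) w = dotv u w + dotv v w.
Proof. by rewrite -big_split; apply: eq_bigr => i _; rewrite mxE mulrDl. Qed.

Lemma dotvZl x u w : dotv (x *: u) w = x * dotv u w.
Proof. by rewrite /dotv mulr_sumr; apply: eq_bigr => i _; rewrite mxE mulrA. Qed.

Lemma dotvBl u v w : dotv (u - v) w = dotv u w - dotv v w.
Proof. by rewrite dotvDl -scaleN1r dotvZl mulN1r. Qed.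

Lemma dotvDr u v w : dotv w (u + v) = dotv w u + dotv w v.
Proof. by rewrite dotvC dotvDl !(dotvC _ w). Qed.

Lemma dotvZr x u w : dotv w (x *: u) = x * dotv w u.
Proof. by rewrite dotvC dotvZl dotvC. Qed.

Lemma dotvBr u v w : dotv w (u - v) = dotv w u - dotv w v.
Proof. by rewrite dotvC dotvBl !(dotvC _ w). Qed.

Lemma dot0v w : dotv 0 w = 0.
Proof. by rewrite -(scale0r 0) dotvZl mul0r. Qed.

Lemma dotv_suml (I : Type) (r : seq I) (F : I -> 'rV[R]_n) w :
  dotv (\sum_(i <- r) F i) w = \sum_(i <- r) dotv (F i) w.
Proof.
by elim/big_rec2: _ => [|i x y _ <-]; rewrite ?dot0v// dotvDl.
Qed.

Lemma dotvv_ge0 u : 0 <= dotv u u.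
Proof. by apply: sumr_ge0 => i _; rewrite -expr2 sqr_ge0. Qed.

Lemma dotvv_eq0 u : (dotv u u == 0) = (u == 0).
Proof.
apply/eqP/eqP => [|->]; last by rewrite dot0v.
move/eqP; rewrite psumr_eq0 => [/allP u0|i _]; last by rewrite -expr2 sqr_ge0.
apply/rowP => i; rewrite mxE; have := u0 i (mem_index_enum _).
by rewrite /= mulf_eq0 orbb => /eqP.
Qed.

Lemma enorm_sqr u : enorm u ^+ 2 = dotv u u.
Proof. by rewrite sqr_sqrtr // dotvv_ge0. Qed.

Lemma enorm_ge0 u : 0 <= enorm u.
Proof. exact: sqrtr_ge0. Qed.

Lemma enorm_gt0 u : (0 < enorm u) = (u != 0).
Proof. by rewrite sqrtr_gt0 lt0r dotvv_ge0 andbT dotvv_eq0. Qed.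

Lemma enorm_le u v : (enorm u <= enorm v) = (dotv u u <= dotv v v).
Proof. by rewrite -!enorm_sqr ler_pXn2r // nnegrE enorm_ge0. Qed.

(* Also when [u = 0], because then [proj_coef v u = 0]. *)
Lemma dotv_proj u v : dotv (v - proj_coef v u *: u) u = 0.
Proof.
rewrite dotvBl dotvZl /proj_coef enorm_sqr.
have [->|u0] := eqVneq u 0; first by rewrite dotvC !dot0v; ring.
by rewrite divfK ?subrr // dotvv_eq0.
Qed.

Lemma gso_rcons b v :
  gso (rcons b v) =
  rcons (gso b) (v - \sum_(c <- gso b) proj_coef v c *: c).
Proof. by rewrite /gso foldl_rcons. Qed.

Lemma gso_orth u b : (forall v, v \in b -> dotv v u = 0) ->
  forall c, c \in gso b -> dotv c u = 0.
Proof.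
elim/last_ind: b => // b v IH bu c; rewrite gso_rcons mem_rcons inE.
have {}IH : forall c, c \in gso b -> dotv c u = 0.
  by apply: IH => w wb; apply: bu; rewrite mem_rcons inE wb orbT.
case/orP => [/eqP->|/IH//]; rewrite dotvBl bu ?mem_rcons ?mem_head//.
rewrite dotv_suml big_seq big1 ?subr0// => d /IH d0.
by rewrite dotvZl d0 mulr0.
Qed.

(** [HKZ] peels off the first vector whereas [gso] appends the last one. The two recursions agree
    because every later Gram-Schmidt vector is orthogonal to [u], so that projecting [v] off [u]
    beforehand does not change its later coefficients. *)
Lemma gso_cons u s :
  gso (u :: s) = u :: gso [seq v - proj_coef v u *: u | v <- s].
Proof.
elim/last_ind: s => [|s v IH].
  by rewrite -[LHS]/[:: u - \sum_(c <- [::]) _] big_nil subr0.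
rewrite -rcons_cons gso_rcons IH map_rcons gso_rcons rcons_cons.
congr (_ :: rcons _ _); rewrite big_cons opprD addrA; congr (_ - _).
rewrite !big_seq; apply: eq_bigr => c cs; congr (_ *: _).
rewrite /proj_coef dotvBl dotvZl (dotvC u c).
by rewrite (gso_orth _ cs) ?mulr0 ?subr0// => w /mapP[x _ ->]; rewrite dotv_proj.
Qed.

End GramSchmidt.

(* [a m l] (m <= l) are the coordinates of a basis in the orthonormal frame of
   its Gram-Schmidt vectors, numbered from the last vector to the first: the
   vectors of index <= d generate the lattice projected orthogonally to the
   vectors that precede the one of index d. *)
Section TriangularBases.
Variable R : realType.
Implicit Types (a : nat -> nat -> R) (z : nat -> R).

Definition lform a z l : R := \sum_(m < l.+1) z m * a m l.

Definition qform a z d : R := \sum_(l < d) lform a z l ^+ 2.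

Definition HKZ_tri (k : nat) a : Prop :=
  forall d, (d < k)%N -> 0 < a d d /\
    forall z : nat -> int, (exists2 m, (m <= d)%N & z m != 0) ->
    a d d ^+ 2 <= qform a (fun m => (z m)%:~R) d.+1.

Lemma qformS a z d : qform a z d.+1 = qform a z d + lform a z d ^+ 2.
Proof. by rewrite /qform big_ord_recr. Qed.

Lemma qform_ge0 a z d : 0 <= qform a z d.
Proof. by apply: sumr_ge0 => i _; rewrite sqr_ge0. Qed.

Lemma eq_qform a a' z d :
  (forall l m, (m <= l)%N -> (l < d)%N -> a m l = a' m l) ->
  qform a z d = qform a' z d.
Proof.
move=> aa'; apply: eq_bigr => l _; congr (_ ^+ 2); apply: eq_bigr => m _.
by rewrite aa' // -ltnS.
Qed.

(** All the forms vanish, and forward substitution from the index 0 clears the coefficients one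
    after the other. *)
Lemma qform_eq0 a z d : (forall l, (l < d)%N -> a l l != 0) ->
  qform a z d = 0 -> forall m, (m < d)%N -> z m = 0.
Proof.
move=> a0 /eqP; rewrite psumr_eq0 => [/allP q0|l _]; last exact: sqr_ge0.
elim/ltn_ind => m IH md; have := q0 (Ordinal md) (mem_index_enum _).
rewrite /= sqrf_eq0 /lform big_ord_recr big1 /= => [|i _].
  by rewrite add0r mulf_eq0 (negPf (a0 m md)) orbF => /eqP.
by rewrite IH ?mul0r // (ltn_trans _ md).
Qed.

(** Coefficients are numbered from the last vector, so that a vector put in front of the basis
    leaves the old numbering unchanged. *)
Definition comb n (b : seq 'rV[R]_n) z : 'rV[R]_n :=
  \sum_(m < size b) z m *: b`_(size b - m.+1).

Lemma combE n (b : seq 'rV[R]_n) z :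
  comb b z = \sum_(m < size b) z (size b - m.+1)%N *: b`_m.
Proof.
rewrite /comb (reindex_inj rev_ord_inj); apply: eq_bigr => m _ /=.
congr (_ *: b`_ _); have := ltn_ord m; lia.
Qed.

Lemma comb_cons n (u : 'rV[R]_n) s z :
  comb (u :: s) z = comb s z + z (size s) *: u.
Proof.
rewrite /comb big_ord_recr /= subnn; congr (_ + _); apply: eq_bigr => m _.
by rewrite subSS -(@subnSK m) //.
Qed.

Lemma lattice_comb n (b : seq 'rV[R]_n) v :
  lattice b v <-> exists z : nat -> int, v = comb b (fun m => (z m)%:~R).
Proof.
split=> -[z ->].
  exists (fun m => z (size b - m.+1)%N); rewrite combE; apply: eq_bigr => m _.
  congr ((z _)%:~R *: _); have := ltn_ord m; lia.
by exists (fun m => z (size b - m.+1)%N); rewrite combE.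
Qed.

End TriangularBases.

(** * HKZ-reduced bases versus triangular coordinates *)

Section Correspondence.
Variable R : realType.
Implicit Types (a : nat -> nat -> R) (z : nat -> R).

Lemma comb_proj n (u : 'rV[R]_n) s z :
  comb [seq v - proj_coef v u *: u | v <- s] z =
  comb s z - proj_coef (comb s z) u *: u.
Proof.
rewrite /comb size_map /proj_coef dotv_suml mulr_suml scaler_suml -sumrB.
apply: eq_bigr => m _; rewrite (nth_map 0); last exact: (ltn_ord (rev_ord m)).
by rewrite scalerBr scalerA dotvZl mulrA.
Qed.

(** Induction on [HKZ]: the projected tail supplies the coordinates below [d], and the coordinate
    [d] is the component along [u], added by Pythagoras. Minimality at level [d] is that of [u]. *)
Lemma tri_of_HKZ n (b : seq 'rV[R]_n) : HKZ b ->
  exists a, [/\ HKZ_tri (size b) a,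
    forall l, (l < size b)%N -> a l l = enorm (gso b)`_(size b - l.+1) &
    forall z, dotv (comb b z) (comb b z) = qform a z (size b)].
Proof.
elim=> [|u s [[zu Lu] u0 umin] _].
  exists (fun _ _ => 0); split => // z.
  by rewrite /comb /qform !big_ord0 dot0v.
set s1 := map _ _; have sz1 : size s1 = size s by rewrite size_map.
rewrite sz1 => -[a1 [H1 D1 Q1]]; set d := size s in H1 D1 Q1.
have nu0 : enorm u != 0 by rewrite gt_eqF ?enorm_gt0.
pose a m l := if l == d then
    (if m == d then enorm u else dotv s`_(d - m.+1) u / enorm u) else a1 m l.
have add : a d d = enorm u by rewrite /a !eqxx.
have eqa z : qform a z d = qform a1 z d.
  by apply: eq_qform => l m _ ld; rewrite /a ltn_eqF.
have lfd z : lform a z d = dotv (comb (u :: s) z) u / enorm u.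
  rewrite comb_cons dotvDl dotvZl -enorm_sqr /lform big_ord_recr /= add mulrDl.
  congr (_ + _); last by rewrite -/d; field.
  rewrite /comb dotv_suml mulr_suml; apply: eq_bigr => m _.
  by rewrite dotvZl /a eqxx ltn_eqF ?mulrA.
have Q z : dotv (comb (u :: s) z) (comb (u :: s) z) = qform a z d.+1.
  rewrite qformS eqa -Q1 comb_proj lfd comb_cons -/d.
  set c := comb s z; set y := z d.
  rewrite dotvBl !dotvBr !(dotvDl, dotvDr, dotvZl, dotvZr) (dotvC u c).
  by rewrite /proj_coef -(enorm_sqr u); field.
have Dpos l : (l < d.+1)%N -> 0 < a l l.
  rewrite ltnS leq_eqVlt => /orP[/eqP->|ld]; first by rewrite add enorm_gt0.
  by rewrite /a ltn_eqF //; case: (H1 _ ld).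
exists a; split => //.
- move=> l ld; split; first exact: Dpos.
  move=> z [m ml zm0]; move: ld; rewrite ltnS leq_eqVlt => /orP[/eqP ld|ld].
    rewrite ld -Q add enorm_sqr -enorm_le; apply: umin.
      by apply/lattice_comb; exists z.
    apply: contra_neq zm0 => c0; have := Q (fun m => (z m)%:~R).
    rewrite c0 dot0v => /esym/qform_eq0 z0.
    have: (z m)%:~R = 0 :> R.
      by apply: z0 => [i /Dpos/gt_eqF->//|]; rewrite ltnS (leq_trans ml) ?ld.
    by move/eqP; rewrite intr_eq0 => /eqP.
  rewrite {1}/a ltn_eqF //; case: (H1 _ ld) => _ /(_ z).
  rewrite (_ : qform a _ _ = qform a1 (fun m => (z m)%:~R) l.+1).
    by apply; exists m.
  apply: eq_qform => i j _ il; rewrite /a ltn_eqF // (leq_trans il) //.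
- move=> l; rewrite ltnS leq_eqVlt => /orP[/eqP->|ld].
    by rewrite add gso_cons subnn.
  by rewrite /a ltn_eqF // D1 // gso_cons [size (_ :: _)]/= subSS -/d -(@subnSK l d).
Qed.

(** The list [s D] consists of the last [D] vectors truncated to the coordinates below [D]. It
    generates the projected lattice of dimension [D], and projecting the tail of [s D.+1] off its
    first vector gives [s D]. *)
Lemma HKZ_of_tri (k : nat) a : HKZ_tri k a ->
  exists b : seq 'rV[R]_k, HKZ_reduced_basis k b /\
    forall l, (l < k)%N -> enorm (gso b)`_(k - l.+1) = a l l.
Proof.
move=> Ha.
pose w D m : 'rV[R]_k := \row_l (if (m <= l < D)%N then a m l else 0).
pose s D := mkseq (fun i => w D (D - i.+1)%N) D.
have sS D : s D.+1 = w D.+1 D :: mkseq (fun i => w D.+1 (D - i.+1)%N) D.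
  rewrite /s /mkseq /= subn1; congr (_ :: _).
  by rewrite [iota 1 D](iotaDl 1 0 D) -map_comp.
have cs D z : (D <= k)%N -> comb (s D) z =
    \row_l (if (l < D)%N then lform a z l else 0).
  move=> Dk; apply/rowP => l; rewrite /comb size_mkseq summxE mxE.
  transitivity (\sum_(m < D) z m * w D m 0 l).
    apply: eq_bigr => m _; rewrite !mxE nth_mkseq; last exact: (ltn_ord (rev_ord m)).
    by rewrite mxE subnSK // subKn // ltnW.
  under eq_bigr do rewrite mxE.
  case: ltnP => [lD|Dl]; last first.
    by rewrite big1 // => m _; rewrite andbF mulr0.
  under eq_bigr do rewrite andbT.
  rewrite /lform (big_ord_widen_cond D predT (fun m => z m * a m l)) //.
  rewrite [RHS]big_mkcond /=; apply: eq_bigr => m _; rewrite ltnS.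
  by case: ifP; rewrite ?mulr0.
have Qs D z : (D <= k)%N -> dotv (comb (s D) z) (comb (s D) z) = qform a z D.
  move=> Dk; rewrite cs // /dotv /qform.
  rewrite (big_ord_widen_cond k predT (fun l => lform a z l ^+ 2)) //.
  rewrite [RHS]big_mkcond /=; apply: eq_bigr => l _; rewrite !mxE.
  by case: ifP => _; rewrite ?mulr0 // expr2.
have pos l : (l < k)%N -> a l l != 0 by move=> /Ha[/gt_eqF->].
have wE D (Dk : (D < k)%N) : w D.+1 D = a D D *: delta_mx 0 (Ordinal Dk).
  apply/rowP => l; rewrite !mxE eqxx /= -val_eqE /= ltnS -eqn_leq eq_sym.
  by case: eqP => [->|_]; rewrite ?mulr1 ?mulr0.
have dw D (Dk : (D < k)%N) v : dotv v (w D.+1 D) = a D D * v 0 (Ordinal Dk).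
  rewrite wE dotvZr /dotv (bigD1 (Ordinal Dk)) //= !mxE !eqxx mulr1.
  rewrite big1 ?addr0 // => l lD.
  by rewrite mxE eqxx (negPf lD) mulr0.
have nw D (Dk : (D < k)%N) : enorm (w D.+1 D) = a D D.
  rewrite /enorm (dw _ Dk) wE !mxE !eqxx mulr1 -expr2 sqrtr_sqr ger0_norm//.
  by case: (Ha _ Dk) => /ltW.
have proj D (Dk : (D < k)%N) :
    [seq v - proj_coef v (w D.+1 D) *: w D.+1 D
       | v <- mkseq (fun i => w D.+1 (D - i.+1)%N) D] = s D.
  rewrite /s /mkseq -map_comp; apply/eq_in_map => i; rewrite mem_iota /= => iD.
  rewrite /proj_coef (dw _ Dk) nw // wE scalerA.
  apply/rowP => l; rewrite !mxE eqxx -val_eqE /=.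
  have [lD|] := eqVneq (l : nat) D.
    rewrite lD ltnn andbF ltnSn andbT leq_subr.
    by rewrite mulr1; have := pos _ Dk; set x := a D D => x0; field.
  by move=> lD; rewrite mulr0 subr0 ltnS [(l <= D)%N]leq_eqVlt (negPf lD).
have HKZs D : (D <= k)%N -> HKZ (s D).
  elim: D => [|D IH] Dk; first exact: HKZ_nil.
  rewrite sS; apply: HKZ_cons; last by rewrite proj //; apply/IH/ltnW.
  have [aD minD] := Ha _ Dk; rewrite -sS; split.
  - apply/lattice_comb; exists (fun m => (m == D)%:Z).
    rewrite sS comb_cons size_mkseq eqxx /= scale1r /comb size_mkseq.
    by rewrite big1 ?add0r // => m _; rewrite ltn_eqF ?scale0r.
  - by rewrite -enorm_gt0 nw.
  - move=> _ /lattice_comb[z ->] c0; rewrite enorm_le -enorm_sqr nw // Qs //.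
    apply: minD; apply: contrapT => z0; move/eqP: c0; apply.
    rewrite /comb size_mkseq big1 // => m _.
    have [->|zm] := eqVneq (z m) 0; first by rewrite scale0r.
    by case: z0; exists m => //; rewrite -ltnS.
exists (s k); split; last first.
  suff gsoE D : (D <= k)%N ->
      forall l, (l < D)%N -> enorm (gso (s D))`_(D - l.+1) = a l l by exact: gsoE.
  elim: D => // D IH Dk l.
  rewrite sS gso_cons proj // ltnS leq_eqVlt => /orP[/eqP->|lD].
    by rewrite subnn /= nw.
  by rewrite subSS -(@subnSK l D) //= IH // ltnW.
split; [exact: size_mkseq | | exact: HKZs].
pose t := @Tuple k _ (s k) (introT eqP (size_mkseq _ k)).
apply/(@freeP _ _ _ t) => c c0 i.
pose z m := if insub (k - m.+1)%N is Some j then c j else 0.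
have zi (j : 'I_k) : z (k - j.+1)%N = c j.
  rewrite /z insubT; first by have := ltn_ord j; lia.
  by move=> h; congr c; apply/val_inj => /=; have := ltn_ord j; lia.
rewrite -zi; apply: (@qform_eq0 _ a z k) => //; last by have := ltn_ord i; lia.
rewrite -Qs // combE size_mkseq (eq_bigr (fun i : 'I_k => c i *: t`_i)).
  by rewrite c0 dot0v.
by move=> j _; rewrite zi.
Qed.

End Correspondence.

(** * Minkowski's bound *)

Section Hermite.
Variable R : realType.
Implicit Types (a : nat -> nat -> R).

Lemma eq_lform a (z z' : nat -> R) l :
  (forall m, (m <= l)%N -> z m = z' m) -> lform a z l = lform a z' l.
Proof. by move=> zz; apply: eq_bigr => m _; rewrite zz // -ltnS. Qed.

Lemma lformB a (z z' : nat -> R) l :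
  lform a (fun m => z m - z' m) l = lform a z l - lform a z' l.
Proof. by rewrite /lform -sumrB; apply: eq_bigr => m _; rewrite mulrBl. Qed.

Lemma bernoulli (x : R) n : 0 <= x <= 1 -> 1 - n%:R * x <= (1 - x) ^+ n.
Proof.
move=> /andP[x0 x1]; elim: n => [|n IH]; first by rewrite mul0r subr0.
rewrite exprS -natr1; apply: le_trans (ler_wpM2l _ IH); last by lra.
have : 0 <= n%:R * x ^+ 2 by rewrite mulr_ge0 // sqr_ge0.
nra.
Qed.

(** The boxes with sides [a l l] tile the space and each contains a lattice point: forward
    substitution moves one coordinate after the other into the box, by removing the integer part of
    [y / a D D]. *)
Lemma lform_cell a D (c : nat -> nat) : (forall l, (l < D)%N -> 0 < a l l) ->
  exists z : nat -> int, forall l, (l < D)%N ->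
    (c l)%:R * a l l <= lform a (fun m => (z m)%:~R) l < (c l).+1%:R * a l l.
Proof.
elim: D => [|D IH] apos; first by exists (fun=> 0).
have [z zP] := IH (fun l lD => apos l (ltnW lD)).
have aD := apos D (ltnSn _).
pose y := \sum_(m < D) (z m)%:~R * a m D.
pose z' m := if m == D then (c D)%:Z - Num.floor (y / a D D) else z m.
exists z' => l; rewrite ltnS leq_eqVlt => /orP[/eqP->|lD]; last first.
  rewrite (@eq_lform _ _ (fun m => (z m)%:~R)) ?zP // => m ml.
  by rewrite /z' ltn_eqF // (leq_ltn_trans ml).
rewrite /lform big_ord_recr /= (eq_bigr (fun m : 'I_D => (z m)%:~R * a m D)).
  rewrite -/y (_ : z' D = (c D)%:Z - Num.floor (y / a D D)); last by rewrite /z' eqxx.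
  rewrite rmorphB /= mulrBl.
  have /andP[] := floor_itv (y / a D D).
  set f : R := (Num.floor _)%:~R; rewrite intrD -/f ler_pdivlMr // ltr_pdivrMr //.
  rewrite -natr1 !mulrDl mul1r => h1 h2; apply/andP; split; lra.
by move=> m _; rewrite /z' ltn_eqF.
Qed.

(** Minkowski's argument by counting. If the inequality failed, a large cube cut into [q ^ D] cells
    of side [h = lam / sqrt D] would contain more than [q ^ D] lattice points, one for each box of
    [lform_cell]. Two points in the same cell differ by a nonzero vector of norm less than
    [h * sqrt D = lam]. *)
Lemma hermite a D (lam : R) : (0 < D)%N -> 0 <= lam ->
  (forall l, (l < D)%N -> 0 < a l l) ->
  (forall z : nat -> int, (exists2 m, (m < D)%N & z m != 0) ->
    lam ^+ 2 <= qform a (fun m => (z m)%:~R) D) ->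
  lam ^+ D <= Num.sqrt D%:R ^+ D * \prod_(l < D) a l l.
Proof.
move=> D0 lam0 apos minD; rewrite leNgt; apply/negP => lamD.
have sD0 : 0 < Num.sqrt (D%:R : R) by rewrite sqrtr_gt0 ltr0n.
have pa0 : 0 < \prod_(l < D) a l l by apply: prodr_gt0 => l _; exact: apos.
pose h := lam / Num.sqrt D%:R.
have lam_gt0 : 0 < lam.
  rewrite lt0r lam0 andbT; apply: contraTneq lamD => ->.
  by rewrite expr0n gtn_eqF //= -leNgt mulr_ge0 ?ltW // exprn_gt0.
have h0 : 0 < h by rewrite divr_gt0.
pose P := \prod_(l < D) (h / a l l).
have P1 : 1 < P.
  rewrite /P big_split /= prodr_const card_ord prodfV ltr_pdivlMr // mul1r.
  by rewrite expr_div_n ltr_pdivlMr ?exprn_gt0 // mulrC.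
(* Slack for rounding: by Bernoulli's inequality [(1 - e) ^ D * P] is at least [(1 + P) / 2], hence
   more than 1. *)
pose e := (1 - P^-1) / (2 * D%:R).
have D1 : 1 <= D%:R :> R by rewrite ler1n.
have iP : 0 < P^-1 < 1 by rewrite invr_gt0 invf_lt1 ?P1 ?(lt_trans _ P1).
have aord (l : 'I_D) : 0 < a l l by exact: apos.
have e_gt0 : 0 < e by rewrite divr_gt0; lra.
have e_le1 : e <= 1 by rewrite ler_pdivrMr; lra.
have De : 1 - D%:R * e = (1 + P^-1) / 2 by rewrite /e; field; lra.
have lam_h : lam ^+ 2 = \sum_(l < D) h ^+ 2.
  rewrite sumr_const card_ord /h expr_div_n sqr_sqrtr ?ler0n // -[RHS]mulr_natr.
  by rewrite divfK // pnatr_eq0 -lt0n.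
clearbody e; clearbody h.
(* With [q > S], each [q * h / a l l] is at least [1 / e], and truncating it to [nn l] costs at most
   a factor [1 - e]. *)
pose S := \sum_(l < D) (e * h / a l l)^-1.
have [q Sq] : exists q : nat, S < q%:R.
  by exists (Num.truncn S).+1; rewrite truncnS_gt.
pose nn l := Num.truncn (q%:R * h / a l l).
have q0 : 0 < q%:R :> R.
  apply: le_lt_trans Sq; apply: sumr_ge0 => l _.
  by rewrite invr_ge0 ltW // divr_gt0 // mulr_gt0.
have ratio_ge0 l : (l < D)%N -> 0 <= q%:R * h / a l l.
  by move=> /apos al; rewrite ltW // divr_gt0 // mulr_gt0.
have nnle l : (l < D)%N -> (nn l)%:R * a l l <= q%:R * h.
  by move=> lD; rewrite -ler_pdivlMr ?truncn_le ?ratio_ge0 // apos.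
have prodn : (q ^ D < \prod_(l < D) nn l)%N.
  rewrite -(ltr_nat R) natrX natr_prod.
  have nn_ge l : (l < D)%N -> q%:R * (1 - e) * (h / a l l) <= (nn l)%:R.
    move=> lD; have al := apos l lD.
    have ehq : 1 <= q%:R * e * (h / a l l).
      have eh0 : 0 < e * h / a l l by rewrite divr_gt0 // mulr_gt0.
      rewrite -mulrA [e * _]mulrA -ler_pdivrMr // mul1r.
      apply: ltW; apply: le_lt_trans Sq; rewrite /S (bigD1 (Ordinal lD)) //= lerDl.
      by apply: sumr_ge0 => i _; rewrite invr_ge0 ltW // divr_gt0 // mulr_gt0.
    have := truncnS_gt (q%:R * h / a l l); rewrite -/(nn l) -natr1.
    rewrite mulrA in ehq *; lra.
  have e1 : 0 <= 1 - e by lra.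
  apply: (@lt_le_trans _ _ (\prod_(l < D) (q%:R * (1 - e) * (h / a l l)))).
    rewrite big_split /= -/P prodr_const card_ord exprMn -mulrA ltr_pMr ?exprn_gt0 //.
    apply: (@lt_le_trans _ _ ((1 - D%:R * e) * P)).
      by rewrite De mulrAC mulrDl mul1r mulVf; lra.
    by rewrite ler_pM2r ?(lt_trans _ P1)// bernoulli //; lra.
  apply: ler_prod => l _; rewrite nn_ge // andbT.
  exact: mulr_ge0 (mulr_ge0 (ltW q0) e1) (ltW (divr_gt0 h0 (aord l))).
pose N := (\max_(l < D) nn l)%N.
pose T := {ffun 'I_D -> 'I_N.+1}.
pose F (l : 'I_D) := [pred j : 'I_N.+1 | (j < nn l)%N].
have cardF : #|family F| = (\prod_(l < D) nn l)%N.
  rewrite card_family foldrE big_map big_enum /=; apply: eq_bigr => l _.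
  have nnN : (nn l <= N.+1)%N by rewrite leqW // /N (bigD1 l) //= leq_maxl.
  by rewrite -sum1_card (big_ord_narrow nnN) sum1_card card_ord.
pose cz (c : T) l := if insub l is Some i then nat_of_ord (c i) else 0%N.
have /choice[zf zfP] : forall c : T, exists z : nat -> int,
    forall l, (l < D)%N ->
    (cz c l)%:R * a l l <= lform a (fun m => (z m)%:~R) l < (cz c l).+1%:R * a l l.
  by move=> c; exact: lform_cell.
have czE (c : T) (i : 'I_D) : cz c i = c i by rewrite /cz valK.
pose L c l : R := lform a (fun m => (zf c m)%:~R) l.
have Lpos c l : (l < D)%N -> 0 <= L c l.
  move=> lD; have /andP[+ _] := zfP c _ lD; apply: le_trans.
  by rewrite mulr_ge0 // ltW // apos.
have q_gt0 : (0 < q)%N by rewrite -(ltr0n R).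
(* The default of [insubd] is never taken on [family F], as [cellE] shows. *)
pose cell (c : T) : {ffun 'I_D -> 'I_q} :=
  [ffun l : 'I_D => insubd (Ordinal q_gt0) (Num.truncn (L c l / h))].
have cellE c (l : 'I_D) : c \in family F -> cell c l = Num.truncn (L c l / h) :> nat.
  move=> cF; rewrite ffunE val_insubd truncn_lt_nat ?divr_ge0 ?Lpos ?ltW //.
  rewrite ifT // ltr_pdivrMr //.
  have /andP[_ Llt] := zfP c _ (ltn_ord l); apply: lt_le_trans Llt _.
  apply: le_trans (nnle _ (ltn_ord l)); rewrite ler_pM2r ?apos // ler_nat czE.
  by have := familyP cF l; rewrite inE.
have [c1 [c2 [c1F c2F c12 cell12]]] : exists c1 c2, [/\ c1 \in family F,
    c2 \in family F, c1 != c2 & cell c1 = cell c2].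
  apply: contrapT => ncol; move: prodn; rewrite -cardF ltnNge => /negP; apply.
  have /card_in_image<- : {in family F &, injective cell}.
    move=> c1 c2 c1F c2F c12; apply/eqP; apply: contrapT => /negP ne.
    by apply: ncol; exists c1, c2.
  by rewrite (leq_trans (max_card _)) // card_ffun !card_ord.
pose z m := zf c1 m - zf c2 m.
have LB l : lform a (fun m => (z m)%:~R) l = L c1 l - L c2 l.
  by rewrite -lformB; apply: eq_lform => m _; rewrite rmorphB.
have zN0 : exists2 m, (m < D)%N & z m != 0.
  apply: contrapT => z0; move/eqP: c12; apply; apply/ffunP => l; apply/val_inj => /=.
  have L12 : L c1 l = L c2 l.
    apply: eq_lform => m ml; apply/eqP; rewrite -subr_eq0 -rmorphB intr_eq0.
    by apply: contrapT => /negP zm; apply: z0; exists m => //; apply: leq_ltn_trans ml _.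
  rewrite -!czE; have := zfP c1 _ (ltn_ord l); have := zfP c2 _ (ltn_ord l).
  have al := apos _ (ltn_ord l).
  rewrite -/(L c1 l) -/(L c2 l) L12 -!ler_pdivlMr // -!ltr_pdivrMr //.
  by move=> /truncn_def<- /truncn_def<-.
have := minD _ zN0; apply/negP; rewrite -ltNge.
rewrite lam_h; apply: ltr_sum => [|l _]; first by apply/hasP; exists (Ordinal D0); rewrite ?mem_index_enum.
rewrite LB -ltr_sqrt; last by rewrite exprn_gt0.
rewrite !sqrtr_sqr (gtr0_norm h0).
have := cellE _ l c1F; have := cellE _ l c2F; rewrite cell12 => -> t12.
have := truncn_itv (divr_ge0 (Lpos c1 _ (ltn_ord l)) (ltW h0)).
have := truncn_itv (divr_ge0 (Lpos c2 _ (ltn_ord l)) (ltW h0)).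
rewrite t12 !ler_pdivlMr // !ltr_pdivrMr // -natr1 mulrDl mul1r.
by rewrite ltr_norml => /andP[? ?] /andP[? ?]; apply/andP; split; lra.
Qed.

End Hermite.

(** * Epstein sums and the choice of a lift *)

Section LatticeSums.
Variable R : realType.

Definition irange (N : nat) : seq int :=
  map Posz (iota 0 N.+1) ++ map Negz (iota 0 N).

Lemma irange_uniq N : uniq (irange N).
Proof.
rewrite cat_uniq !map_inj_uniq ?iota_uniq ?andbT /= => [|i j []//|i j []//].
by apply/hasPn => _ /mapP[i _ ->]; apply/negP => /mapP[].
Qed.

Lemma mem_irange N q : (q \in irange N) = (`|q| <= N)%N.
Proof.
rewrite mem_cat; case: q => n.
  rewrite mem_map ?mem_iota ?ltnS; last by move=> i j [].
  by rewrite (introF mapP) ?orbF // => -[].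
rewrite (introF mapP) /=; last by case.
by rewrite mem_map ?mem_iota //; move=> i j [].
Qed.

Lemma big_irange N (F : nat -> R) :
  \sum_(q <- irange N) F `|q|%N = \sum_(i < N.+1) F i + \sum_(i < N) F i.+1.
Proof.
rewrite big_cat !big_map.
rewrite -(big_mkord predT (fun i => F i)) -(big_mkord predT (fun i => F i.+1)).
by rewrite /index_iota !subn0.
Qed.

Lemma ler_sum_subset (s t : seq int) (F : int -> R) : uniq s -> uniq t ->
  {subset s <= t} -> (forall q, 0 <= F q) ->
  \sum_(q <- s) F q <= \sum_(q <- t) F q.
Proof.
move=> us ut st F0; rewrite [leRHS](bigID (mem s) predT) /= -[leLHS]addr0.
apply: lerD; last by apply: sumr_ge0.
rewrite -[leRHS]big_filter; have st' : perm_eq s [seq q <- t | q \in s]; last first.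
  by rewrite (perm_big _ st').
apply: uniq_perm => //; first exact: filter_uniq.
by move=> q; rewrite mem_filter; case: (boolP (q \in s)) => // /st->.
Qed.

(** Telescoping substitute for the integral of [1 / (1 + (y t) ^ 2)]: the inequality
    [2 (1 + u ^ 2) >= (1 + u) ^ 2] bounds each term by an increment of
    [2 / y * (1 - 1 / (1 + y n))]. *)
Lemma sum_inv_sqr_nat N (y : R) : 0 < y ->
  \sum_(i < N) (1 + y ^+ 2 * i.+1%:R ^+ 2)^-1 <= 2 / y.
Proof.
move=> y0; suff: \sum_(i < N) (1 + y ^+ 2 * i.+1%:R ^+ 2)^-1 <=
    2 / y * (1 - (1 + y * N%:R)^-1).
  move/le_trans; apply; have y2 : 0 <= 2 / y by rewrite divr_ge0 // ltW.
  rewrite ler_piMr // gerBl invr_ge0.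
  by rewrite addr_ge0 // mulr_ge0 // ltW.
elim: N => [|N IH]; first by rewrite big_ord0 mulr0 addr0 invr1 subrr mulr0.
rewrite big_ord_recr /=; apply: le_trans (lerD IH (lexx _)) _.
have N0 : 0 <= N%:R :> R by [].
rewrite -(natr1 N); set v := N%:R in N0 *.
have yv : 0 <= y * v by rewrite mulr_ge0 // ltW.
rewrite -lerBrDl.
have -> : 2 / y * (1 - (1 + y * (v + 1))^-1) - 2 / y * (1 - (1 + y * v)^-1) =
    2 / ((1 + y * v) * (1 + y * (v + 1))).
  by field; rewrite ?gt_eqF //; nra.
rewrite ler_pdivlMr; last by apply: mulr_gt0; nra.
rewrite mulrC ler_pdivrMr; last by nra.
have := sqr_ge0 (1 - y * (v + 1)); nra.
Qed.

Lemma sum_inv_sqr (s : seq int) (y : R) : uniq s -> 0 < y -> y <= 1 ->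
  \sum_(q <- s) (1 + y ^+ 2 * q%:~R ^+ 2)^-1 <= 5 / y.
Proof.
move=> us y0 y1; pose N := (\max_(q <- s) `|q|)%N.
pose F (i : nat) : R := (1 + y ^+ 2 * i%:R ^+ 2)^-1.
have FE (q : int) : (1 + y ^+ 2 * q%:~R ^+ 2)^-1 = F `|q|%N.
  by rewrite /F natr_absz intr_norm real_normK ?num_real.
have F0 q : 0 <= F q by rewrite invr_ge0 addr_ge0 // mulr_ge0 // sqr_ge0.
under eq_bigr do rewrite FE.
apply: le_trans (_ : \sum_(q <- irange N) F `|q|%N <= _).
  apply: ler_sum_subset => // [|q qs]; first exact: irange_uniq.
  by rewrite mem_irange /N (big_rem q) //= leq_maxl.
rewrite big_irange big_ord_recl /= {1}/F expr0n mulr0 addr0 invr1.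
(* The constant is 5 = 1 + 2 + 2: the term of index 0, which is at most [1 / y], and the two
   half-lines. *)
have S := sum_inv_sqr_nat N y0; rewrite -/F in S.
have y1' : 1 <= y^-1 by rewrite invf_ge1.
apply: le_trans (lerD (lerD (lexx _) S) S) _; lra.
Qed.

(** Bernoulli's inequality for [(1 + v) ^ (K / 2)], with [K / 2] rounded down, which is still at
    least [K / 4]. *)
Lemma inv_sqrt_expr K (v : R) : (1 < K)%N -> 0 <= v ->
  (Num.sqrt (1 + v)) ^- K <= (1 + K%:R / 4 * v)^-1.
Proof.
move=> K1 v0; have v1 : 1 <= Num.sqrt (1 + v).
  by rewrite -[leLHS]sqrtr1 ler_wsqrtr // lerDl.
rewrite lef_pV2 ?posrE ?exprn_gt0 ?(lt_le_trans _ v1) //; last first.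
  by rewrite ltr_pwDl // mulr_ge0 // divr_ge0.
apply: (@le_trans _ _ (Num.sqrt (1 + v) ^+ (K./2).*2)); last first.
  by rewrite ler_weXn2l // -[leqRHS]odd_double_half leq_addl.
rewrite -mul2n exprM sqr_sqrtr; last by rewrite addr_ge0.
apply: (@le_trans _ _ (1 + K./2%:R * v)).
  rewrite lerD2l ler_wpM2r // ler_pdivrMr // -natrM ler_nat; lia.
elim: (K./2) => [|j IH]; first by rewrite mul0r addr0.
rewrite exprS -natr1; apply: le_trans (ler_wpM2l _ IH); last by lra.
have : 0 <= j%:R * v ^+ 2 by rewrite mulr_ge0 // sqr_ge0.
nra.
Qed.

(* A Riemann sum of [fun y => sqrt (r ^ 2 + y ^ 2) ^ (- K)] of mesh [x / p]. *)
Lemma sum_line (s : seq int) K (r x : R) p : uniq s -> (1 < K)%N ->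
  0 < r -> 0 < x -> (0 < p)%N -> Num.sqrt K%:R * x <= 2 * r * p%:R ->
  \sum_(q <- s) Num.sqrt (r ^+ 2 + (x * q%:~R / p%:R) ^+ 2) ^- K <=
  p%:R * (10 / (Num.sqrt K%:R * x) * r ^- K.-1).
Proof.
move=> us K1 r0 x0 p0 hp; have p0' : 0 < p%:R :> R by rewrite ltr0n.
have sK : 0 < Num.sqrt K%:R :> R by rewrite sqrtr_gt0 ltr0n (ltn_trans _ K1).
(* Chosen so that [(y q) ^ 2] is [K / 4] times the square of [x q / (p r)], as [inv_sqrt_expr]
   demands. *)
pose y := Num.sqrt K%:R * x / (2 * r * p%:R).
have y0 : 0 < y by rewrite divr_gt0 ?mulr_gt0.
have y1 : y <= 1 by rewrite ler_pdivrMr ?mul1r ?mulr_gt0.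
apply: (@le_trans _ _ (\sum_(q <- s) r ^- K * (1 + y ^+ 2 * q%:~R ^+ 2)^-1)).
  apply: ler_sum => q _; pose v := (x * q%:~R / p%:R / r) ^+ 2.
  have -> : r ^+ 2 + (x * q%:~R / p%:R) ^+ 2 = r ^+ 2 * (1 + v).
    by rewrite /v; field; rewrite !gt_eqF.
  rewrite sqrtrM ?sqr_ge0 // sqrtr_sqr gtr0_norm // exprMn invfM.
  rewrite ler_wpM2l ?invr_ge0 ?exprn_ge0 ?(ltW r0) //.
  have -> : y ^+ 2 * q%:~R ^+ 2 = K%:R / 4 * v.
    rewrite /y /v -exprMn; set t := q%:~R; set S := Num.sqrt _.
    have <- : S ^+ 2 = K%:R by rewrite sqr_sqrtr.
    by field; rewrite !gt_eqF.
  by rewrite inv_sqrt_expr // sqr_ge0.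
rewrite -mulr_sumr; apply: le_trans (ler_wpM2l _ (sum_inv_sqr us y0 y1)) _.
  by rewrite invr_ge0 exprn_ge0 // ltW.
case: K K1 sK @y {y0 y1 hp} => // K K1 sK; rewrite /= exprS.
set S := Num.sqrt _ in sK *; rewrite le_eqVlt; apply/orP; left; apply/eqP.
have rK : r ^+ K != 0 by rewrite expf_neq0 // gt_eqF.
by field; rewrite rK !gt_eqF.
Qed.

End LatticeSums.

(** * Averaging over the lifts of a projected lattice *)

Section Extension.
Variable R : realType.
Implicit Types (a : nat -> nat -> R).

Fixpoint box (N d : nat) : seq (seq int) :=
  if d is d'.+1 then [seq rcons z q | z <- box N d', q <- irange N]
  else [:: [::]].

Lemma boxS N d : box N d.+1 = [seq rcons z q | z <- box N d, q <- irange N].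
Proof. by []. Qed.

Definition nonzero (z : seq int) : bool := has (fun q => q != 0) z.

Definition ivec (z : seq int) (m : nat) : R := (z`_m)%:~R.

Lemma mem_box N d z : z \in box N d ->
  size z = d /\ forall m, (`|(z`_m)%R|%N <= N)%N.
Proof.
elim: d z => [|d IH] z.
  by rewrite inE => /eqP->; split => // m; rewrite nth_nil.
rewrite boxS.
move=> /allpairsPdep[z' [q [/IH[sz zN] + ->]]]; rewrite mem_irange => qN.
split=> [|m]; first by rewrite size_rcons sz.
by rewrite nth_rcons sz; case: ifP => // _; case: ifP.
Qed.

Lemma box_mkseq N d (z : nat -> int) : (forall m, (m < d)%N -> (`|z m| <= N)%N) ->
  mkseq z d \in box N d.
Proof.
elim: d => [|d IH] zN; first by rewrite inE.
rewrite mkseqS boxS; apply: allpairs_f; last by rewrite mem_irange zN.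
by apply: IH => m md; apply: zN; rewrite ltnW.
Qed.

Lemma big_box0 N d (F : seq int -> R) :
  \sum_(z <- box N d | ~~ nonzero z) F z = F (nseq d 0).
Proof.
elim: d F => [|d IH] F; first by rewrite big_cons big_nil addr0.
rewrite big_mkcond boxS big_allpairs_dep.
under eq_bigr => z _ do rewrite -big_mkcond.
pose G z := F (rcons z 0).
transitivity (\sum_(z <- box N d | ~~ nonzero z) G z).
  rewrite [RHS]big_mkcond; apply: eq_bigr => z _.
  rewrite (eq_bigl (fun q => (q == 0) && ~~ nonzero z)); last first.
    by move=> q; rewrite /nonzero has_rcons negb_or negbK.
  case: (nonzero z) => /=; first by rewrite big1 // => q; rewrite andbF.
  under eq_bigl do rewrite andbT.
  by rewrite -big_filter (filter_pred1_uniq (irange_uniq N)) ?mem_irange // big_seq1.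
rewrite IH /G; congr F; rewrite -[d.+1]addn1 nseqD cats1.
by [].
Qed.

(** Balanced digits in base [2 N + 1]: a number with [d] such digits stays below half of the next
    power, hence the lower digits cannot cancel a nonzero one. *)
Lemma lt_sum_base N d (z : nat -> int) : (forall m, (m < d)%N -> (`|z m| <= N)%N) ->
  (2 * `|(\sum_(m < d) z m * ((2 * N).+1 ^ m)%:Z)%R|%N < (2 * N).+1 ^ d)%N.
Proof.
elim: d => [|d IH] zN; first by rewrite big_ord0 expn0.
rewrite big_ord_recr /=; have {}IH := IH (fun m md => zN m (ltnW md)).
have := zN d (ltnSn d); rewrite expnS.
set S := \sum_(m < d) _ in IH *; set B := (_ ^ d)%N in IH *.
move=> zd; apply: leq_ltn_trans (_ : 2 * (`|S| + N * B) < _)%N; last by nia.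
rewrite leq_mul2l /=; have tri (u v : int) : (`|(u + v)%R| <= `|u| + `|v|)%N by lia.
by rewrite (leq_trans (tri _ _)) // leq_add2l abszM absz_nat leq_mul2r zd orbT.
Qed.

Lemma sum_base_neq0 N d (z : nat -> int) : (forall m, (m < d)%N -> (`|z m| <= N)%N) ->
  (exists2 m, (m < d)%N & z m != 0) ->
  \sum_(m < d) z m * ((2 * N).+1 ^ m)%:Z != 0.
Proof.
elim: d => [_ []//|d IH] zN [m md zm].
rewrite big_ord_recr /=; have zN' m' (m'd : (m' < d)%N) := zN m' (ltnW m'd).
have [z0|z0] := eqVneq (z d) 0.
  rewrite z0 mul0r addr0; apply: IH => //; exists m => //.
  move: md; rewrite ltnS leq_eqVlt => /orP[/eqP md|//]; by move: zm; rewrite md z0 eqxx.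
have := lt_sum_base zN'; set S := \sum_(m < d) _; set B := (_ ^ d)%N => SB.
apply/eqP => /eqP; rewrite addr_eq0 => /eqP SE; move: SB.
rewrite SE abszN abszM absz_nat; have : (0 < `|z d|)%N by rewrite absz_gt0.
by nia.
Qed.

(* With the weights [x / p * (tau * B ^ m mod p)], a nonzero coefficient vector
   of the box is sent, as [tau] varies, to all the residues modulo [p]. *)
Definition residue_form (p B d : nat) (z : nat -> int) (tau : nat) (q : int) : int :=
  p%:Z * q + \sum_(m < d) z m * ((tau * B ^ m) %% p)%N%:Z.

(** Modulo [p] the form equals [tau * S], where [S] is the nonzero number with balanced digits [z],
    and [|S| < p]. Since [p] is prime, the residue determines [tau], and then the value determines
    [q]. *)
Lemma residue_form_uniq p N d z : prime p -> ((2 * N).+1 ^ d <= p)%N ->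
  (forall m, (m < d)%N -> (`|z m| <= N)%N) ->
  (exists2 m, (m < d)%N & z m != 0) ->
  uniq [seq residue_form p (2 * N).+1 d z tau q | tau <- iota 0 p, q <- irange N].
Proof.
move=> pp Bp zN z0; set B := (2 * N).+1.
pose S := \sum_(m < d) z m * (B ^ m)%:Z.
have Slt : (`|S| < p)%N by rewrite (leq_trans _ Bp) // (leq_ltn_trans _ (lt_sum_base zN)) // leq_pmull.
have S0 : (0 < `|S|)%N by rewrite absz_gt0 (sum_base_neq0 zN z0).
pose W tau := \sum_(m < d) z m * ((tau * B ^ m) %/ p)%N%:Z.
have formE tau q : residue_form p B d z tau q = p%:Z * (q - W tau) + tau%:Z * S.
  rewrite /residue_form mulrBr -addrA /W /S !mulr_sumr -sumrN -big_split /=.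
  congr (_ + _); apply: eq_bigr => m _; have := divn_eq (tau * B ^ m) p.
  set e := (_ %% _)%N; set f := (_ %/ _)%N => /(congr1 Posz).
  by rewrite PoszD !PoszM => h; rewrite (_ : e%:Z = tau%:Z * (B ^ m)%:Z - f%:Z * p%:Z); [ring|rewrite h; ring].
apply: allpairs_uniq; rewrite ?iota_uniq ?irange_uniq //.
move=> _ _ /allpairsPdep[t1 [q1 [t1p _ ->]]] /allpairsPdep[t2 [q2 [t2p _ ->]]].
rewrite /= !formE => eq12.
have dvd12 : (p %| (t1%:Z - t2%:Z)%R * S)%Z.
  apply/dvdzP; exists (q2 - W t2 - (q1 - W t1)).
  have -> : (t1%:Z - t2%:Z) * S = p%:Z * (q1 - W t1) + t1%:Z * S
     - p%:Z * (q1 - W t1) - t2%:Z * S by ring.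
  by rewrite eq12; ring.
have t12 : t1 = t2.
  move: dvd12; rewrite dvdzE absz_nat abszM Euclid_dvdM // => /orP[] /dvdn_leq.
    by move: t1p t2p; rewrite !mem_iota !add0n /= => t1p t2p h; lia.
  by move=> /(_ S0); rewrite leqNgt Slt.
congr (_, _) => //; move: eq12; rewrite t12 => /addIr /mulfI h.
by apply: (addIr (- W t2)); apply: h; rewrite -lt0n prime_gt0.
Qed.

(** [x] is the norm of the new Gram-Schmidt vector, of index [d]; [t m] measures, in units of [x],
    the lift of the old vector of index [m] in that direction. *)
Definition ext a d x (t : nat -> R) m l : R :=
  if l == d then (if m == d then x else x * t m) else a m l.

Lemma qform_ext a d x t z D : (D <= d)%N -> qform (ext a d x t) z D = qform a z D.
Proof.
by move=> Dd; apply: eq_qform => l m _ lD; rewrite /ext ltn_eqF // (leq_trans lD).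
Qed.

Lemma lform_ext a d x t z :
  lform (ext a d x t) z d = x * (z d + \sum_(m < d) z m * t m).
Proof.
rewrite /lform big_ord_recr /= /ext !eqxx mulrDr mulr_sumr addrC mulrC.
by congr (_ + _); apply: eq_bigr => m _; rewrite ltn_eqF // mulrCA.
Qed.

Lemma eq_qformz a (z z' : nat -> R) d :
  (forall m, (m < d)%N -> z m = z' m) -> qform a z d = qform a z' d.
Proof.
move=> zz; apply: eq_bigr => l _; congr (_ ^+ 2); apply: eq_lform => m ml.
by rewrite zz // (leq_ltn_trans ml).
Qed.

(** The Epstein sum of [|v| ^ -K], truncated to the box; it is used with [K = d + 1]. *)
Definition zeta a N d K : R :=
  \sum_(z <- box N d | nonzero z) Num.sqrt (qform a (ivec z) d) ^- K.

(** Mean over the [p] lifts [t tau]. For a fixed nonzero [z], the new coordinates are [x / p] times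
    integers that are all distinct as [tau] and [q] vary, so [sum_line] bounds the total; some [tau]
    does at least as well as the mean. *)
Lemma extend N d a (x delta E : R) : 0 < x -> 0 < delta ->
  (forall z, z \in box N d -> nonzero z -> delta <= Num.sqrt (qform a (ivec z) d)) ->
  zeta a N d d.+1 <= E ->
  exists2 t : nat -> R, forall m, 0 <= t m <= 1 &
    \sum_(z <- box N d | nonzero z) \sum_(q <- irange N)
      Num.sqrt (qform (ext a d x t) (ivec (rcons z q)) d.+1) ^- d.+2
    <= 10 / (Num.sqrt d.+2%:R * x) * E.
Proof.
move=> x0 d0 dmin zE; set B := (2 * N).+1.
(* With [p >= C] the mesh is fine enough for [sum_line] at every radius from [delta] on;
   [p >= B ^ d] serves the distinctness of the integers. *)
pose C := Num.sqrt d.+2%:R * x / (2 * delta).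
have [p pbig pp] := prime_above (maxn (B ^ d) (Num.truncn C).+1).
have Bp : (B ^ d <= p)%N by apply: leq_trans (ltnW pbig); exact: leq_maxl.
have Cp : C <= p%:R.
  apply/ltW/(lt_le_trans (truncnS_gt C)); rewrite ler_nat.
  by apply: leq_trans (ltnW pbig); exact: leq_maxr.
have p0 : (0 < p)%N := prime_gt0 pp.
have p0' : 0 < p%:R :> R by rewrite ltr0n.
pose t tau m : R := ((tau * B ^ m) %% p)%N%:R / p%:R.
have t01 tau m : 0 <= t tau m <= 1.
  by rewrite divr_ge0 //= ler_pdivrMr // mul1r ler_nat ltnW // ltn_mod.
pose G tau := \sum_(z <- box N d | nonzero z) \sum_(q <- irange N)
      Num.sqrt (qform (ext a d x (t tau)) (ivec (rcons z q)) d.+1) ^- d.+2.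
have QE tau z q : z \in box N d ->
    qform (ext a d x (t tau)) (ivec (rcons z q)) d.+1 =
    Num.sqrt (qform a (ivec z) d) ^+ 2 +
    (x * (residue_form p B d (fun m => z`_m) tau q)%:~R / p%:R) ^+ 2.
  move=> /mem_box[sz _]; rewrite qformS qform_ext // sqr_sqrtr ?qform_ge0 //.
  congr (_ + _ ^+ 2).
    by apply: eq_qformz => m md; rewrite /ivec nth_rcons sz md.
  rewrite lform_ext -mulrA; congr (x * _).
  rewrite {1}/ivec nth_rcons sz ltnn eqxx /residue_form rmorphD /= mulrDl.
  rewrite rmorphM /= mulrAC divff ?mul1r ?gt_eqF //; congr (_ + _).
  rewrite rmorph_sum /= mulr_suml; apply: eq_bigr => m _.
  by rewrite /ivec nth_rcons sz ltn_ord rmorphM /= /t mulrA.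
have sumG : \sum_(tau <- iota 0 p) G tau <=
    \sum_(tau <- iota 0 p) 10 / (Num.sqrt d.+2%:R * x) * E.
  rewrite /G exchange_big /= [leRHS]big_const_seq count_predT size_iota iter_addr addr0.
  apply: (@le_trans _ _ (p%:R * (10 / (Num.sqrt d.+2%:R * x) * zeta a N d d.+1))).
    rewrite /zeta !mulr_sumr [leLHS]big_seq_cond [leRHS]big_seq_cond.
    apply: ler_sum => z /andP[zbox z0].
    have [sz zN] := mem_box zbox.
    have dz := dmin _ zbox z0; have rz0 := lt_le_trans d0 dz.
    set rz := Num.sqrt (qform a (ivec z) d) in dz rz0 *.
    pose s := [seq residue_form p B d (fun m => z`_m) tau q | tau <- iota 0 p, q <- irange N].
    apply: (@le_trans _ _ (\sum_(q <- s)
        Num.sqrt (rz ^+ 2 + (x * q%:~R / p%:R) ^+ 2) ^- d.+2)).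
      rewrite big_allpairs_dep le_eqVlt; apply/orP; left; apply/eqP.
      by apply: eq_bigr => tau _; apply: eq_bigr => q _; rewrite QE.
    apply: sum_line => //.
      apply: residue_form_uniq => //.
      by have /hasP[q /(nthP 0)[m mz <-] q0] := z0; exists m; rewrite -?sz.
    have : C <= p%:R by []; rewrite ler_pdivrMr ?mulr_gt0 // => /le_trans; apply.
    by rewrite [leRHS]mulrC; apply: ler_wpM2l => //; rewrite ler_wpM2l.
  rewrite -[leRHS]mulr_natl; apply: ler_wpM2l => //; apply: ler_wpM2l => //.
  by rewrite divr_ge0 // mulr_ge0 ?sqrtr_ge0 // ltW.
have [tau _ Gtau] : exists2 tau, tau \in iota 0 p & G tau <= 10 / (Num.sqrt d.+2%:R * x) * E.
  apply: contrapT => noG; move: sumG; apply/negP; rewrite -ltNge.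
  rewrite [ltLHS]big_seq [ltRHS]big_seq; apply: ltr_sum.
    by apply/hasP; exists 0%N; rewrite ?mem_iota.
  move=> tau tp; rewrite ltNge; apply/negP => Gt; apply: noG; by exists tau.
by exists (t tau).
Qed.

End Extension.

(** * Inductive construction of HKZ-reduced bases with prescribed Gram-Schmidt norms *)

Section Existence.
Variable R : realType.
Implicit Types (a : nat -> nat -> R).

(** Bounds the coefficients of a vector shorter than [T] times each Gram-Schmidt norm: the newest
    one is below [T] up to the lifts of the older ones. The factor [d] exceeds the number of older
    coefficients by one, which makes the bound monotone in [d]. *)
Fixpoint coef_bound (T d : nat) : nat :=
  if d is d'.+1 then (T + d * coef_bound T d')%N else 0%N.

Lemma coef_boundS T d : coef_bound T d.+1 = (T + d.+1 * coef_bound T d)%N.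
Proof. by []. Qed.

Lemma coef_bound_le T d k : (d <= k)%N -> (coef_bound T d <= coef_bound T k)%N.
Proof.
elim: k => [|k IH]; first by rewrite leqn0 => /eqP->.
rewrite leq_eqVlt => /orP[/eqP->//|/IH/leq_trans]; apply.
by rewrite coef_boundS; nia.
Qed.

Lemma sum_multiples N K (x : R) : (1 < K)%N -> 0 < x ->
  \sum_(q <- irange N) (`|q|%N%:R * x) ^- K <= 8 * x ^- K.
Proof.
move=> K1 x0; have xK : 0 <= x ^- K by rewrite invr_ge0 exprn_ge0 // ltW.
rewrite (big_irange N (fun i => (i%:R * x) ^- K)) big_ord_recl /=.
(* The term of index 0 is 0, by the convention that the inverse of 0 is 0. *)
rewrite mul0r expr0n gtn_eqF ?(ltn_trans _ K1) //= invr0 add0r.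
suff S : \sum_(i < N) (i.+1%:R * x) ^- K <= 4 * x ^- K.
  by apply: le_trans (lerD S S) _; rewrite -mulrDl; lra.
apply: (@le_trans _ _ (\sum_(i < N) (2 * x ^- K) * (1 + 1 ^+ 2 * i.+1%:R ^+ 2)^-1)).
  apply: ler_sum => i _; rewrite exprMn invfM mulrC -mulrA mulrCA.
  apply: ler_wpM2l => //; set v : R := i.+1%:R.
  have v1 : 1 <= v by rewrite ler1n.
  have v2 : v ^+ 2 <= v ^+ K by rewrite ler_weXn2l.
  have vK : 0 < v ^+ K by rewrite exprn_gt0 //; lra.
  rewrite expr1n mul1r -[2 * _]invf_div lef_pV2 ?posrE //; first nra.
  by rewrite divr_gt0 // addr_gt0 // exprn_gt0 //; lra.
rewrite -mulr_sumr; apply: le_trans (ler_wpM2l _ (sum_inv_sqr_nat N ltr01)) _.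
  by rewrite mulr_ge0.
lra.
Qed.

Variables (k : nat) (x : nat -> R).
Hypothesis x_gt0 : forall d, 0 < x d.
Hypothesis x_ratio : forall d,
  (x d.+1 / x d) ^+ d.+2 <= Num.sqrt d.+3%:R / 180.

(** [rho] exceeds every [x l], so only vectors shorter than [rho] can violate minimality;
    [T * x l >= rho], and the box of size [N] contains the coefficients of all those vectors. *)
Let rho : R := 1 + \sum_(l < k) x l.
Let T : nat := \sum_(l < k) (Num.truncn (rho / x l)).+1.
Let N : nat := coef_bound T k.
Let zbound d : R := if d is d'.+1 then 9 * x d' ^- d.+1 else 0.

(** Invariant of the construction: the Epstein sum controls the whole box, and the last clause
    ensures that the box misses no short vector. *)
Let admissible d a : Prop :=
  [/\ forall l, (l < d)%N -> a l l = x l, HKZ_tri d a,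
      zeta a N d d.+1 <= zbound d &
      forall z : nat -> int, qform a (fun m => (z m)%:~R) d < rho ^+ 2 ->
        forall m, (m < d)%N -> (`|z m| <= coef_bound T d)%N].

Let x_lt_rho l : (l < k)%N -> x l < rho.
Proof.
move=> lk; rewrite /rho (bigD1 (Ordinal lk)) //=.
have : 0 <= \sum_(i < k | i != Ordinal lk) x i by apply: sumr_ge0 => i _; apply: ltW.
by set S := \sum_(i < k | _) _; lra.
Qed.

Let T_ge l : (l < k)%N -> rho <= T%:R * x l.
Proof.
move=> lk; rewrite -ler_pdivrMr //; apply: ltW; apply: lt_le_trans (truncnS_gt _) _.
by rewrite ler_nat /T (bigD1 (Ordinal lk)) //= leq_addr.
Qed.

(** Vectors with a nonzero projection are handled by [extend]: their sum is at most half of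
    [x d ^- d.+2], so none is shorter than [x d]. The others are multiples of the new vector and add
    at most 8 times that power, whence the constant 9 of [zbound]. *)
Let step d a : (d < k)%N -> admissible d a ->
  exists a', admissible d.+1 a'.
Proof.
move=> dk [diag Ha za coef]; have xd := x_gt0 d.
(* The minimum of the old lattice; in dimension 0 there is no nonzero vector and any positive value
   serves. *)
pose delta := if d is d'.+1 then x d' else 1.
have delta0 : 0 < delta by rewrite /delta; case: (d).
have rho0 : 0 < rho := lt_trans xd (x_lt_rho dk).
have ivecE (z : nat -> int) D m : (m < D)%N -> ivec R (mkseq z D) m = (z m)%:~R.
  by move=> md; rewrite /ivec nth_mkseq.
have dmin z : z \in box N d -> nonzero z -> delta <= Num.sqrt (qform a (ivec R z) d).
  move=> /mem_box[sz _] /hasP[q /(nthP 0)[m mz <-] q0].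
  rewrite -[leLHS]gtr0_norm // -sqrtr_sqr ler_wsqrtr //.
  move: mz Ha diag @delta {delta0 coef za dk xd}; rewrite sz.
  case: (d) => // d' md Ha diag /=; rewrite -diag //.
  by have [_ /(_ (fun m => z`_m))] := Ha d' (ltnSn d'); apply; exists m.
have [t t01 tz] := extend xd delta0 dmin za.
set a' := ext a d (x d) t in tz; exists a'.
(* The constant 180 of [x_ratio] is 2 * 10 * 9: the desired half, the constant of [extend] and that
   of [zbound]. *)
have half : 10 / (Num.sqrt d.+2%:R * x d) * zbound d <= 2^-1 * x d ^- d.+2.
  rewrite /zbound; case: (d) (x_gt0 d) => [|d'] xd'.
    by rewrite mulr0 mulr_ge0 // invr_ge0 exprn_ge0 // ltW.
  have := x_ratio d'; set s := Num.sqrt _ => xr; have xd'0 := x_gt0 d'.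
  have s0 : 0 < s by rewrite sqrtr_gt0.
  have -> : x d'.+1 ^- d'.+3 =
      x d' ^- d'.+2 * (x d'.+1 / x d') ^- d'.+2 * (x d'.+1)^-1.
    by rewrite expr_div_n invf_div [_ ^+ d'.+3]exprS; field; rewrite !expf_neq0 ?gt_eqF.
  set r := _ ^+ d'.+2 in xr *; have r0 : 0 < r by rewrite exprn_gt0 // divr_gt0.
  set y := x d' ^- d'.+2; have y0 : 0 < y by rewrite invr_gt0 exprn_gt0.
  rewrite (_ : _ * _ = 90 / s * (y / x d'.+1)); last by field; rewrite !gt_eqF.
  rewrite (_ : 2^-1 * _ = (2^-1 / r) * (y / x d'.+1)); last by field; rewrite !gt_eqF.
  rewrite ler_pM2r ?divr_gt0 // ler_pdivrMr // mulrAC ler_pdivlMr //; lra.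
have nz_part z q : z \in box N d -> nonzero z -> q \in irange N ->
    x d <= Num.sqrt (qform a' (ivec R (rcons z q)) d.+1).
  move=> zb z0 qN; set Q := Num.sqrt _.
  have Q0 : 0 < Q.
    rewrite sqrtr_gt0 qformS qform_ext //; apply: ltr_wpDr; first exact: sqr_ge0.
    have [sz _] := mem_box zb; have := lt_le_trans delta0 (dmin _ zb z0).
    rewrite sqrtr_gt0 (@eq_qformz _ _ _ (ivec R z)) // => m md.
    by rewrite /ivec nth_rcons sz md.
  have : Q ^- d.+2 <= x d ^- d.+2.
    apply: (@le_trans _ _ (2^-1 * x d ^- d.+2)); last first.
      by rewrite ler_piMl ?invr_ge0 ?exprn_ge0 // ?(ltW xd) //; lra.
    apply: le_trans half; apply: le_trans tz.
    rewrite (big_rem z) //= z0 (big_rem q) //= -addrA lerDl.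
    apply: addr_ge0; first by apply: sumr_ge0 => *; rewrite invr_ge0 exprn_ge0 // sqrtr_ge0.
    by do 2!apply: sumr_ge0 => ? _; rewrite invr_ge0 exprn_ge0 // sqrtr_ge0.
  by rewrite lef_pV2 ?posrE ?exprn_gt0 // ler_pXn2r // nnegrE ltW.
have coef' (z : nat -> int) : qform a' (fun m => (z m)%:~R) d.+1 < rho ^+ 2 ->
    forall m, (m < d.+1)%N -> (`|z m| <= coef_bound T d.+1)%N.
  rewrite qformS qform_ext // => Qz.
  have zle m : (m < d)%N -> (`|z m| <= coef_bound T d)%N.
    by apply: coef; apply: le_lt_trans Qz; rewrite lerDl sqr_ge0.
  have : lform a' (fun m => (z m)%:~R) d ^+ 2 < rho ^+ 2.
    by apply: le_lt_trans Qz; rewrite lerDr qform_ge0.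
  rewrite -ltr_sqrt ?exprn_gt0 // !sqrtr_sqr (gtr0_norm rho0) lform_ext => zd m.
  rewrite ltnS leq_eqVlt => /orP[/eqP->|md]; last first.
    by apply: leq_trans (zle _ md) _; rewrite coef_boundS; nia.
  move: zd; rewrite normrM (gtr0_norm xd) => /lt_le_trans/(_ (T_ge dk)).
  rewrite mulrC ltr_pM2r // => zT.
  have S : `|\sum_(i < d) (z i)%:~R * t i| <= (d * coef_bound T d)%:R.
    apply: le_trans (ler_norm_sum _ _ _) _.
    apply: (@le_trans _ _ (\sum_(i < d) (coef_bound T d)%:R)).
      apply: ler_sum => i _; have /andP[t0 t1] := t01 i.
      rewrite normrM (ger0_norm t0); apply: le_trans (ler_piMr _ t1) _ => //.
      by rewrite -intr_norm -natr_absz ler_nat zle.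
    by rewrite sumr_const card_ord -[leLHS]mulr_natr -natrM mulnC.
  rewrite -(ler_nat R) natr_absz intr_norm coef_boundS natrD mulSn.
  have := ler_normB ((z d)%:~R + \sum_(i < d) (z i)%:~R * t i) (\sum_(i < d) (z i)%:~R * t i).
  rewrite addrK natrD => h; apply: le_trans h _; have : 0 <= (coef_bound T d)%:R :> R by [].
  lra.
split => //.
- move=> l; rewrite ltnS leq_eqVlt => /orP[/eqP->|ld]; first by rewrite /a' /ext !eqxx.
  by rewrite /a' /ext ltn_eqF // diag.
- move=> l; rewrite ltnS leq_eqVlt => /orP[/eqP->|ld]; last first.
    have [al minl] := Ha _ ld; rewrite {1 2}/a' /ext ltn_eqF //; split => // z z0.
    by rewrite qform_ext // minl.
  have a'd : a' d d = x d by rewrite /a' /ext !eqxx.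
  rewrite a'd; split => // z [m md zm].
  have [rhoQ|Qrho] := lerP (rho ^+ 2) (qform a' (fun m => (z m)%:~R) d.+1).
    apply: le_trans rhoQ; rewrite ler_pXn2r // ?nnegrE ?ltW //.
    exact: x_lt_rho.
  have zN i : (i < d.+1)%N -> (`|z i| <= N)%N.
    by move=> /(coef' _ Qrho)/leq_trans; apply; exact: coef_bound_le.
  have [z0|/hasPn z0] := boolP (nonzero (mkseq z d)).
    have /nz_part/(_ z0)/(_ (_ : z d \in _)) : mkseq z d \in box N d.
      by apply: box_mkseq => i id; apply: zN; rewrite ltnW.
    rewrite mem_irange zN // => /(_ isT) xQ.
    rewrite -[leLHS]ger0_norm ?sqr_ge0 // -(@eq_qformz _ _ (ivec R (rcons (mkseq z d) (z d)))).
      rewrite -(sqr_sqrtr (qform_ge0 _ _ _)) ger0_norm ?sqr_ge0 //.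
      by rewrite ler_pXn2r ?nnegrE ?sqrtr_ge0 ?(ltW xd).
    move=> i; rewrite ltnS leq_eqVlt /ivec nth_rcons size_mkseq => /orP[/eqP->|id].
      by rewrite ltnn eqxx.
    by rewrite id nth_mkseq.
  have z0' i : (i < d)%N -> z i = 0.
    move=> id; apply/eqP; have := z0 (z i); rewrite negbK; apply.
    by apply/mapP; exists i; rewrite ?mem_iota.
  have zd : z d != 0.
    by move: md; rewrite leq_eqVlt => /orP[/eqP<-//|/z0' zm0]; rewrite zm0 in zm.
  rewrite qformS lform_ext big1 ?addr0 => [|i _]; last by rewrite z0' ?mul0r.
  rewrite exprMn -[leLHS]mulr1; apply: ler_wpDl; first exact: qform_ge0.
  rewrite ler_pM2l ?exprn_gt0 // -(real_normK (num_real _)) -intr_norm -natr_absz.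
  by rewrite -natrX ler1n expn_gt0 absz_gt0 zd.
- rewrite /zeta big_mkcond boxS big_allpairs_dep (bigID nonzero) /=.
  have sum1 : \sum_(z <- box N d | nonzero z) \sum_(q <- irange N)
      (if nonzero (rcons z q) then
        Num.sqrt (qform a' (ivec R (rcons z q)) d.+1) ^- d.+2 else 0)
      <= 2^-1 * x d ^- d.+2.
    apply: le_trans half; apply: le_trans tz.
    apply: ler_sum => z _; apply: ler_sum => q _; case: ifP => _; first exact: lexx.
    by rewrite invr_ge0 exprn_ge0 // sqrtr_ge0.
  rewrite (big_box0 N d (fun z => \sum_(q <- irange N)
      (if nonzero (rcons z q) then
        Num.sqrt (qform a' (ivec R (rcons z q)) d.+1) ^- d.+2 else 0))).
  have sum2 : \sum_(q <- irange N)
      (if nonzero (rcons (nseq d 0) q) then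
        Num.sqrt (qform a' (ivec R (rcons (nseq d 0) q)) d.+1) ^- d.+2 else 0)
      <= 8 * x d ^- d.+2.
    apply: le_trans (sum_multiples N (_ : 1 < d.+2)%N xd) => //.
    apply: ler_sum => q _; case: ifP => _; last first.
      by rewrite invr_ge0 exprn_ge0 // mulr_ge0 // ltW.
    rewrite (@eq_qformz _ _ _ (fun m => if m == d then q%:~R else 0)); last first.
      move=> m; rewrite ltnS leq_eqVlt /ivec nth_rcons size_nseq.
      move=> /orP[/eqP->|md]; first by rewrite ltnn eqxx.
      by rewrite md ltn_eqF // nth_nseq md.
    rewrite qformS lform_ext big1 ?addr0 => [|i _]; last by rewrite ltn_eqF ?mul0r.
    rewrite eqxx /qform big1 ?add0r; last first.
      move=> l _; rewrite /lform big1 ?expr0n // => m _.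
      by rewrite ltn_eqF ?mul0r // (leq_trans (ltn_ord m)).
    by rewrite sqrtr_sqr normrM (gtr0_norm xd) mulrC natr_absz intr_norm.
  apply: le_trans (lerD sum1 sum2) _; rewrite -mulrDl ler_pM2r; last first.
    by rewrite invr_gt0 exprn_gt0.
  lra.
Qed.

Lemma exists_tri : exists2 a, HKZ_tri k a & forall l, (l < k)%N -> a l l = x l.
Proof.
suff H d : (d <= k)%N -> exists a, admissible d a.
  by have [a [? ? _ _]] := H k (leqnn k); exists a.
elim: d => [|d IH] dk; last by have [a] := IH (ltnW dk); exact: step.
exists (fun _ _ => 0); split => //.
by rewrite /zeta big_cons big_nil /=.
Qed.

End Existence.

(** * Logarithmic profiles *)

Section LogSums.
Variable R : realType.
Implicit Types (F : nat -> R).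

Lemma ln_le_sub1 (x : R) : 0 < x -> ln x <= x - 1.
Proof. by move=> x0; have := expR_ge1Dx (ln x); rewrite lnK ?posrE //; lra. Qed.

Lemma ln_nat_ge0 n : 0 <= ln (n%:R : R).
Proof. by case: n => [|n]; [rewrite ln0|rewrite ln_ge0 // ler1n]. Qed.

Lemma ln_natS_le n : ln (n.+1%:R : R) <= n%:R.
Proof.
have n0 : (0 : R) < n.+1%:R by rewrite ltr0n.
by have := ln_le_sub1 n0; rewrite -(natr1 n); lra.
Qed.

Lemma ln_natS_sub n : (0 < n)%N ->
  n.+1%:R^-1 <= ln (n.+1%:R : R) - ln n%:R <= n%:R^-1.
Proof.
move=> n0; have n0' : 0 < n%:R :> R by rewrite ltr0n.
have n1 : 0 < n.+1%:R :> R by rewrite ltr0n.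
have := @ln_le_sub1 (n.+1%:R / n%:R) (divr_gt0 n1 n0').
have := @ln_le_sub1 (n%:R / n.+1%:R) (divr_gt0 n0' n1).
rewrite !ln_div ?posrE //.
have -> : n%:R / n.+1%:R - 1 = - (n.+1%:R)^-1 :> R by rewrite -natr1; field; rewrite natr1 gt_eqF.
have -> : n.+1%:R / n%:R - 1 = (n%:R)^-1 :> R by rewrite -natr1; field; rewrite gt_eqF.
by move=> h1 h2; rewrite h2 andbT -lerN2 opprB.
Qed.

Definition mean F d : R := (\sum_(i < d) F i) / d%:R.

Lemma meanS F d : (0 < d)%N ->
  mean F d.+1 - mean F d = (d%:R * F d - \sum_(i < d) F i) / (d%:R * d.+1%:R).
Proof.
move=> d0; have d0' : d%:R != 0 :> R by rewrite pnatr_eq0 -lt0n.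
have d1 : d%:R + 1 != 0 :> R by rewrite natr1 pnatr_eq0.
by rewrite /mean big_ord_recr /= -natr1; field; rewrite d0' d1.
Qed.

Lemma telescope_le (u v : nat -> R) d e : (d <= e)%N ->
  (forall i, (d <= i)%N -> (i < e)%N -> u i.+1 - u i <= v i.+1 - v i) ->
  u e - u d <= v e - v d.
Proof.
elim: e => [|e IH]; first by rewrite leqn0 => /eqP-> _; rewrite !subrr.
rewrite leq_eqVlt => /orP[/eqP<- _|de uv]; first by rewrite !subrr.
have IH' := IH de (fun i di ie => uv i di (ltnW ie)).
by have := uv e de (ltnSn e); lra.
Qed.

(** An antiderivative of [ln t / t]: its increments replace the terms [ln n / n]. *)
Definition hlog n : R := ln n%:R ^+ 2 / 2.

(** The errors are multiples of [ln n.+1 - ln n], so that they telescope to multiples of a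
    logarithm. *)
Lemma hlogS n : (0 < n)%N ->
  hlog n.+1 - hlog n <= ln n.+1%:R / n.+1%:R + (ln n.+1%:R - ln n%:R) /\
  ln n.+1%:R / n%:R <=
    hlog n.+1 - hlog n + 3 / 2 * (ln n.+1%:R - ln n%:R).
Proof.
move=> n0; rewrite /hlog; have /andP[] := ln_natS_sub n0.
have := ln_natS_le n; have := ln_nat_ge0 n.
have n0' : 1 <= n%:R :> R by rewrite ler1n.
set L := ln n%:R; set L' := ln n.+1%:R => L0 L'n h1 h2.
pose D := L' - L; have DE : L' = L + D by rewrite /D; ring.
rewrite -/D in h1 h2.
have i1 : (n%:R)^-1 = (n.+1%:R)^-1 + (n%:R)^-1 * (n.+1%:R)^-1 :> R.
  by rewrite -natr1; field; rewrite natr1 !gt_eqF ?ltr0n ?(lt_le_trans ltr01).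
have i2 : 0 < (n.+1%:R)^-1 :> R by rewrite invr_gt0.
have i3 : L' * (n%:R)^-1 <= 1 by rewrite ler_pdivrMr ?mul1r // (lt_le_trans _ n0').
have L'0 : 0 <= L' by exact: ln_nat_ge0.
have D1 : D <= 1 by apply: le_trans h2 _; rewrite invf_le1 // (lt_le_trans _ n0').
set w := (n.+1%:R)^-1 in i1 i2 h1 *; set v := (n%:R)^-1 in i1 i3 h2 *.
have i4 : L' * v = L' * w + L' * v * w by rewrite {1}i1; ring.
have i5 : L' * v * w <= w by rewrite ler_piMl // ltW.
have i6 : 0 <= L' * (D - w) by rewrite mulr_ge0 // subr_ge0.
have i7 : 0 <= L' * (v - D) by rewrite mulr_ge0 // subr_ge0.
have D0 : 0 <= D by apply: le_trans h1; apply: ltW.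
have i8 : 0 <= D * (1 - D) by rewrite mulr_ge0 // subr_ge0.
have i9 : 0 <= D * D by rewrite mulr_ge0.
have -> : L = L' - D by rewrite DE; ring.
split; nra.
Qed.

(** The hypothesis is Minkowski's inequality in logarithmic form; it says that the mean grows from
    [i] to [i + 1] terms by at most [ln (i + 1) / (2 i)], which [hlogS] telescopes. *)
Lemma mean_le F k d e :
  (forall l, (l < k)%N ->
    l.+1%:R * F l <= l.+1%:R / 2 * ln l.+1%:R + \sum_(i < l.+1) F i) ->
  (0 < d)%N -> (d <= e)%N -> (e <= k)%N ->
  mean F e - mean F d <=
    (hlog e - hlog d) / 2 + 3 / 4 * (ln e%:R - ln d%:R).
Proof.
move=> HF d0 de ek.
pose v n : R := hlog n / 2 + 3 / 4 * ln n%:R.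
have : mean F e - mean F d <= v e - v d; last by rewrite /v; lra.
apply: telescope_le => // i di ie; rewrite meanS ?(leq_trans d0) //.
have i0 : (0 < i)%N := leq_trans d0 di.
have [_] := hlogS i0; rewrite /v.
have := HF i (leq_trans ie ek); rewrite big_ord_recr /=.
have i0' : 0 < i%:R :> R by rewrite ltr0n.
have i1' : 0 < i.+1%:R :> R by rewrite ltr0n.
set S := \sum_(j < i) _ => h1 h2.
have : (i%:R * F i - S) / (i%:R * i.+1%:R) <= (ln i.+1%:R / i%:R) / 2.
  rewrite ler_pdivrMr ?mulr_gt0 //.
  have -> : ln i.+1%:R / i%:R / 2 * (i%:R * i.+1%:R) = i.+1%:R / 2 * ln i.+1%:R :> R.
    by field; rewrite gt_eqF.
  by move: h1; rewrite -(natr1 i); lra.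
move: h2; set X := _ / i%:R; set Y := _ / (_ * _).
by set L' := ln i.+1%:R; set L := ln i%:R; lra.
Qed.

(* The profile for which the Epstein sums of [exists_tri] stay bounded. *)
Fixpoint log_profile d : R :=
  if d is d'.+1 then
    log_profile d' + ln (Num.sqrt d'.+3%:R / 180) / d'.+2%:R
  else 0.

(** [ln 180] is the loss in the growth condition; the 1 absorbs two losses of 1 / 2 in the induction
    of [log_profile_ge]. *)
Let C : R := 1 + ln 180.

Lemma log_profile_ratio d :
  (expR (log_profile d.+1) / expR (log_profile d)) ^+ d.+2 <=
  Num.sqrt d.+3%:R / 180.
Proof.
rewrite -expRN -expRD -expRM_natl /= addrAC subrr add0r mulrC divfK ?pnatr_eq0 //.
by rewrite lnK // posrE divr_gt0 // sqrtr_gt0.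
Qed.

(** A converse of Minkowski's inequality up to the constant [C]. Passing from [d] to [d + 1] adds
    [d + 1] times the new increment [G], that is [ln (d + 3) / 2 - ln 180 - G], with
    [G <= 1 / 2]. *)
Lemma log_profile_ge d :
  d%:R * (ln d.+1%:R / 2 - C) <=
  d%:R * log_profile d - \sum_(i < d) log_profile i.
Proof.
elim: d => [|d IH]; first by rewrite !mul0r big_ord0 subr0.
rewrite big_ord_recr; set S := \sum_(i < d) _ in IH *.
have : log_profile d.+1 = log_profile d + ln (Num.sqrt d.+3%:R / 180) / d.+2%:R by [].
set F' := log_profile d.+1; set F := log_profile d in IH *.
rewrite ln_div ?posrE ?sqrtr_gt0 // -powR12_sqrt // ln_powR.
have := ln_natS_le d.+2; have := ln_nat_ge0 d.+3.
have L12 : ln d.+1%:R <= ln (d.+2%:R : R) by rewrite ler_ln ?posrE // ler_nat.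
have L23 : ln d.+2%:R <= ln (d.+3%:R : R) by rewrite ler_ln ?posrE // ler_nat.
have /andP[_ ] := @ln_natS_sub d.+1 isT.
have c0 : 0 <= ln 180 :> R by exact: ln_nat_ge0.
rewrite /C in IH *; move: IH.
set c := ln 180 in c0 *.
set L1 := ln d.+1%:R in L12 *; set L2 := ln d.+2%:R in L12 L23 *; set L3 := ln d.+3%:R in L23 *.
have n1 : d.+1%:R = d%:R + 1 :> R by rewrite natr1.
have n2 : d.+2%:R = d%:R + 2 :> R by rewrite -!natr1; ring.
rewrite n1 n2 /=; have : 0 <= d%:R :> R by [].
set n := d%:R => nn0 IH h2 h3 h4 FE.
have FE' : (n + 2) * F' = (n + 2) * F + (L3 / 2 - c).
  by rewrite FE; field; rewrite gt_eqF //; lra.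
have h2' : (n + 1) * L2 <= (n + 1) * L1 + 1.
  have : (n + 1) * (L2 - L1) <= 1 by rewrite mulrC -ler_pdivlMr ?div1r //; lra.
  lra.
have : (n + 2) * (F' - F) = L3 / 2 - c by rewrite mulrBr FE'; ring.
set G := F' - F => GE.
have G1 : (n + 1) * G >= L3 / 2 - 1 / 2 - c.
  have : G <= 1 / 2.
    have : (n + 2) * G <= (n + 2) * (1 / 2) by rewrite GE; lra.
    by rewrite ler_pM2l //; lra.
  lra.
have FG : F' = F + G by rewrite /G; ring.
rewrite FG.
nra.
Qed.

End LogSums.

(** * Size reduction and existence of the maxima *)

Section SizeReduction.
Variable R : realType.
Implicit Types (a : nat -> nat -> R).

(** The vector of index [j] is reduced by those of larger index in turn: rounding to the nearest
    integer settles coordinate [l], which coefficients of index beyond [l] do not affect. *)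
Lemma reducing_row k a j D : (D <= k)%N -> (forall l, (l < k)%N -> 0 < a l l) ->
  exists z : nat -> int,
    [/\ forall m, (m < j)%N -> z m = 0, z j = 1 &
        forall l, (j < l < D)%N -> `|lform a (fun m => (z m)%:~R) l| <= a l l / 2].
Proof.
move=> + apos; elim: D => [|D IH] Dk.
  exists (fun m => (m == j)%:Z); split => [m mj||l]; last by rewrite andbF.
    by rewrite ltn_eqF.
  by rewrite eqxx.
have [z [z0 zj zD]] := IH (ltnW Dk); have aD := apos _ Dk.
have [Dj|jD] := leqP D j.
  exists z; split => // l; rewrite ltnS => /andP[jl lD].
  by have := leq_trans jl (leq_trans lD Dj); rewrite ltnn.
pose y := \sum_(m < D) (z m)%:~R * a m D.
pose f := Num.floor (y / a D D + 1 / 2).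
exists (fun m => if m == D then - f else z m); split.
- by move=> m mj; rewrite ltn_eqF ?z0 // (ltn_trans mj).
- by rewrite ltn_eqF.
move=> l /andP[jl]; rewrite ltnS leq_eqVlt => /orP[/eqP->|lD]; last first.
  rewrite (@eq_lform _ _ _ (fun m => (z m)%:~R)) ?zD ?jl // => m ml.
  by rewrite ltn_eqF // (leq_ltn_trans ml).
rewrite /lform big_ord_recr /= eqxx (eq_bigr (fun m : 'I_D => (z m)%:~R * a m D)).
  rewrite -/y; have /andP[] := floor_itv (y / a D D + 1 / 2); rewrite -/f.
  rewrite intrD rmorphN /= => h1 h2.
  have yE : y = (y / a D D) * a D D by rewrite divfK // gt_eqF.
  rewrite yE -mulrDl normrM (gtr0_norm aD) mulrC ler_pM2l // ler_norml.
  by apply/andP; split; lra.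
by move=> m _; rewrite ltn_eqF.
Qed.

(** The rows of [reducing_row] form a unitriangular integer matrix, so the lattices and the diagonal
    do not change. *)
Lemma size_reduce k a : HKZ_tri k a -> exists a',
  [/\ HKZ_tri k a', forall l, (l < k)%N -> a' l l = a l l,
      forall m l, (l < m)%N -> a' m l = 0 &
      forall m l, (m < l < k)%N -> `|a' m l| <= a l l / 2].
Proof.
move=> Ha; have apos l (lk : (l < k)%N) : 0 < a l l by have [] := Ha l lk.
have /choice[U UP] : forall j, exists z : nat -> int,
    [/\ forall m, (m < j)%N -> z m = 0, z j = 1 &
        forall l, (j < l < k)%N -> `|lform a (fun m => (z m)%:~R) l| <= a l l / 2].
  by move=> j; exact: reducing_row apos.
pose a' m l := lform a (fun i => (U m i)%:~R) l.
have diag l : (l < k)%N -> a' l l = a l l.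
  move=> _; have [U0 U1 _] := UP l; rewrite /a' /lform big_ord_recr /= U1 mul1r.
  by rewrite big1 ?add0r // => i _; rewrite U0 ?mul0r.
pose phi (z : nat -> int) i := \sum_(m < i.+1) z m * U m i.
have lE z l : lform a' (fun m => (z m)%:~R) l = lform a (fun m => (phi z m)%:~R) l.
  rewrite {1}/lform /a'; under eq_bigr do rewrite /lform mulr_sumr.
  rewrite exchange_big /=; apply: eq_bigr => i _.
  rewrite /phi rmorph_sum mulr_suml (big_ord_widen_cond l.+1 predT
    (fun m => (z m * U m i)%:~R * a i l)) //.
  rewrite [RHS]big_mkcond /=; apply: eq_bigr => m _; rewrite ltnS rmorphM mulrA.
  case: leqP => // im; have [U0 _ _] := UP m.
  by rewrite U0 // mulr0 mul0r.
exists a'; split => //.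
- move=> d dk; rewrite diag //; split; first exact: apos.
  move=> z [m md zm]; have [_ minD] := Ha _ dk.
  rewrite (_ : qform a' _ _ = qform a (fun m => (phi z m)%:~R) d.+1).
    (* At the least index with [z m != 0] the old coefficient [phi z m] equals [z m], the diagonal
       of [U] being 1. *)
    apply: minD; have ex : exists m, z m != 0 by exists m.
    exists (ex_minn ex); case: ex_minnP => i zi imin.
      exact: leq_trans (imin _ zm) md.
    rewrite /phi big_ord_recr /= big1 ?add0r => [|n _].
      by have [_ -> _] := UP i; rewrite mulr1.
    have [->|/imin] := eqVneq (z n) 0; first by rewrite mul0r.
    by rewrite leqNgt ltn_ord.
  by apply: eq_bigr => l _; rewrite lE.
- move=> m l lm; rewrite /a' /lform big1 // => i _; have [U0 _ _] := UP m.
  by rewrite U0 ?mul0r // (leq_trans (ltn_ord i)).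
- by move=> m l ml; have [_ _] := UP m; apply.
Qed.

(** A discrete Gronwall inequality; the induction carries the partial sums along. *)
Lemma growth (X : nat -> R) n : (forall m, 0 <= X m) ->
  (forall m, (m <= n)%N -> X m <= X 0%N + (\sum_(s < m) X s.+1) / 4) ->
  forall m, (m <= n)%N -> X m <= 2 ^+ m * X 0%N.
Proof.
move=> X0 HX m mn.
suff [] : X m <= 2 ^+ m * X 0%N /\ \sum_(s < m) X s.+1 <= (2 * 2 ^+ m - 2) * X 0%N by [].
elim: m mn => [|m IH] mn.
  by rewrite expr0 mul1r big_ord0 mulr1 subrr mul0r.
have [_ IHs] := IH (ltnW mn); have := HX _ mn; rewrite !big_ord_recr /= exprS.
have : 1 <= 2 ^+ m :> R by rewrite exprn_ege1 // ler1n.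
set S := \sum_(s < m) _ in IHs *; have := X0 m.+1; have := X0 0%N.
by move=> h1 h2 h3 h4; split; nra.
Qed.

(** Minimality of [a i i] is tested on the vector of index [j] of a size-reduced basis: its squared
    norm is at most [a j j ^ 2] plus a quarter of the squares of the diagonal entries from [j + 1]
    to [i], and [growth] applies. *)
Lemma HKZ_tri_diag k a i j : HKZ_tri k a -> (j <= i < k)%N ->
  a i i ^+ 2 <= 2 ^+ (i - j) * a j j ^+ 2.
Proof.
move=> /size_reduce[a' [Ha' diag a'0 a'2]] /andP[ji ik].
pose X n := a (j + n)%N (j + n)%N ^+ 2.
have := @growth X (i - j); rewrite /X addn0 => /(_ _ _ (i - j)%N (leqnn _)).
rewrite subnKC //; apply => [m|m mij]; first exact: sqr_ge0.
have jmk : (j + m < k)%N by lia.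
have [_ /(_ (fun l => (l == j)%:Z))] := Ha' _ jmk; rewrite diag //.
move=> /(_ (ex_intro2 _ _ j (leq_addr _ _) _)); rewrite eqxx => /(_ isT).
move=> /le_trans; apply.
have lE l : lform a' (fun m => (m == j)%:Z%:~R) l = if (j <= l)%N then a' j l else 0.
  rewrite /lform; case: ifP => jl.
    have jl' : (j < l.+1)%N by [].
    rewrite (bigD1 (Ordinal jl')) //= eqxx mul1r big1 ?addr0 // => s sj.
    by rewrite (_ : (s == j :> nat) = false) ?mul0r //; apply/eqP => sj'; case/eqP: sj; apply/val_inj.
  by rewrite big1 // => s _; rewrite (_ : (s == j :> nat) = false) ?mul0r //; have := ltn_ord s; lia.
rewrite /qform -addnS big_split_ord /= big1 ?add0r => [|l _]; last first.
  by rewrite lE leqNgt ltn_ord expr0n.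
rewrite big_ord_recl /= lE addn0 leqnn diag ?(leq_ltn_trans ji) // lerD2l mulr_suml.
apply: ler_sum => s _; rewrite lE leq_addr /=.
have sk : (j + s.+1 < k)%N by have := ltn_ord s; lia.
have /a'2 : (j < j + s.+1 < k)%N by rewrite sk andbT -addSnnS leq_addr.
move=> h; rewrite -real_normK ?num_real //.
have -> : a (j + s.+1)%N (j + s.+1)%N ^+ 2 / 4 = (a (j + s.+1)%N (j + s.+1)%N / 2) ^+ 2.
  by field.
by rewrite ler_pXn2r // nnegrE // (le_trans _ h).
Qed.

End SizeReduction.

(** * Compactness of the normalized reduced bases *)

Section MaximumAttained.
Import numFieldNormedType.Exports.
Local Open Scope classical_set_scope.
Variable R : realType.
Implicit Types (a : nat -> nat -> R) (x : nat -> R).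

Definition sqr_ratio (s t : seq nat) x : R :=
  (\prod_(i <- s) x i ^+ 2) / (\prod_(i <- t) x i ^+ 2).

Lemma HKZ_tri_scale k a (c : R) : 0 < c -> HKZ_tri k a ->
  HKZ_tri k (fun m l => c * a m l).
Proof.
move=> c0 Ha d dk; have [ad minD] := Ha d dk; split; first exact: mulr_gt0.
move=> z z0; rewrite exprMn (_ : qform _ _ _ =
    c ^+ 2 * qform a (fun m => (z m)%:~R) d.+1).
  by rewrite ler_pM2l ?exprn_gt0 // minD.
rewrite /qform mulr_sumr; apply: eq_bigr => l _; rewrite -exprMn.
congr (_ ^+ 2); rewrite /lform mulr_sumr; apply: eq_bigr => m _.
by rewrite mulrCA.
Qed.

Lemma HKZ_tri_id k : HKZ_tri k (fun m l => (m == l)%:R : R).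
Proof.
move=> d dk; rewrite eqxx; split=> // z [m md zm]; rewrite expr1n.
have lE l : lform (fun m l => (m == l)%:R : R) (fun m => (z m)%:~R) l = (z l)%:~R.
  rewrite /lform big_ord_recr /= eqxx mulr1 big1 ?add0r // => i _.
  by rewrite ltn_eqF ?mulr0.
rewrite /qform (bigD1 (Ordinal (md : (m < d.+1)%N))) //= lE.
apply: ler_wpDr; first by apply: sumr_ge0 => i _; rewrite sqr_ge0.
by rewrite -real_normK ?num_real // -intr_norm -natr_absz -natrX ler1n expn_gt0 absz_gt0 zm.
Qed.

Lemma sqr_ratio_scale (s t : seq nat) (c : R) x : c != 0 -> size s = size t ->
  sqr_ratio s t (fun l => c * x l) = sqr_ratio s t x.
Proof.
move=> c0 st; rewrite /sqr_ratio.
have E (u : seq nat) : \prod_(i <- u) (c * x i) ^+ 2 =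
    (c ^+ 2) ^+ size u * \prod_(i <- u) x i ^+ 2.
  under eq_bigr do rewrite exprMn.
  by rewrite big_split /= big_const_seq count_predT -Monoid.iteropE.
by rewrite !E st -mulf_div divff ?mul1r // !expf_neq0.
Qed.

Lemma eq_sqr_ratio k (s t : seq nat) x y : all (fun i => i < k)%N s ->
  all (fun i => i < k)%N t -> (forall l, (l < k)%N -> x l = y l) ->
  sqr_ratio s t x = sqr_ratio s t y.
Proof.
have E (u : seq nat) : all (fun i => i < k)%N u ->
    (forall l, (l < k)%N -> x l = y l) ->
    \prod_(i <- u) x i ^+ 2 = \prod_(i <- u) y i ^+ 2.
  by move=> /allP uk xy; apply: eq_big_seq => i /uk/xy->.
by move=> sk tk xy; rewrite /sqr_ratio !E.
Qed.

(* The entry of index (m, l) of the k x k matrix listed in the row v. *)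
Definition entry k (v : 'rV[R]_(k * k)) (m l : nat) : R :=
  if insub m is Some i then if insub l is Some j then v 0 (mxvec_index i j) else 0
  else 0.

Lemma entry_continuous k m l : continuous (fun v : 'rV[R]_(k * k) => entry v m l).
Proof.
rewrite /entry; case: insub => [i|]; last exact: cst_continuous.
by case: insub => [j|]; [exact: coord_continuous|exact: cst_continuous].
Qed.

Lemma entry_mxvec k a m l : (m < k)%N -> (l < k)%N ->
  entry (mxvec (\matrix_(i < k, j < k) a i j)) m l = a m l.
Proof. by move=> mk lk; rewrite /entry !insubT mxvecE mxE. Qed.

Lemma continuous_mul (T : topologicalType) (f g : T -> R) :
  continuous f -> continuous g -> continuous (fun v => f v * g v).
Proof. by move=> cf cg v; apply: cvgM; [exact: cf|exact: cg]. Qed.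

Lemma continuous_div (T : topologicalType) (f g : T -> R) v :
  continuous f -> continuous g -> g v != 0 ->
  {for v, continuous (fun v => f v / g v)}.
Proof.
move=> cf cg g0; apply: cvgM; first exact: cf.
by apply: cvgV => //; exact: cg.
Qed.

Lemma continuous_sqr (T : topologicalType) (f : T -> R) :
  continuous f -> continuous (fun v => f v ^+ 2).
Proof. by move=> cf; under eq_fun do rewrite expr2; exact: continuous_mul. Qed.

Lemma continuous_bigsum (T : topologicalType) n (f : nat -> T -> R) :
  (forall i, continuous (f i)) -> continuous (fun v => \sum_(i < n) f i v).
Proof.
move=> cf; elim: n => [|n IH].
  under eq_fun do rewrite big_ord0; exact: cst_continuous.
under eq_fun do rewrite big_ord_recr /=.
by move=> v; apply: cvgD; [exact: IH|exact: cf].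
Qed.

Lemma continuous_prod_sqr (T : topologicalType) (s : seq nat) (f : nat -> T -> R) :
  (forall i, continuous (f i)) -> continuous (fun v => \prod_(i <- s) f i v ^+ 2).
Proof.
move=> cf; elim: s => [|i s IH].
  under eq_fun do rewrite big_nil; exact: cst_continuous.
under eq_fun do rewrite big_cons.
by apply: continuous_mul; [exact: continuous_sqr|].
Qed.

Lemma closed_le_fun (T : topologicalType) (f g : T -> R) :
  continuous f -> continuous g -> closed [set v | f v <= g v].
Proof.
move=> cf cg; rewrite (_ : [set v | _] = (fun v => g v - f v) @^-1` [set y | 0 <= y]).
  apply: preimage_closed; last exact: closed_ge.
  by move=> v _; apply: cvgB; [exact: cg|exact: cf].
by apply/seteqP; split => v /=; rewrite subr_ge0.
Qed.

Lemma qform_continuous k (z : nat -> R) d :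
  continuous (fun v : 'rV[R]_(k * k) => qform (entry v) z d).
Proof.
refine (@continuous_bigsum _ d (fun l (v : 'rV[R]_(k * k)) => lform (entry v) z l ^+ 2) _) => l.
have cl : continuous (fun v : 'rV[R]_(k * k) => lform (entry v) z l).
  refine (@continuous_bigsum _ l.+1 (fun m (v : 'rV[R]_(k * k)) => z m * entry v m l) _) => m.
  apply: continuous_mul; [exact: cst_continuous|exact: entry_continuous].
exact: continuous_sqr.
Qed.

(** The bound [c] replaces the open condition of positivity; minimality is a family of closed
    conditions, one for each coefficient vector. *)
Lemma HKZ_tri_compact k (c M : R) : 0 < c -> compact
  [set v : 'rV[R]_(k * k) | [/\ forall i, - M <= v 0 i <= M,
     forall l, (l < k)%N -> c <= entry v l l & HKZ_tri k (entry v)]].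
Proof.
move=> c0; pose B := [set v : 'rV[R]_(k * k) | forall i, v ord0 i \in `[- M, M]%R].
have cB : compact B.
  apply: (@rV_compact _ _ (fun=> `[- M, M]%classic)) .
  by move=> _; exact: segment_compact.
pose C1 := \bigcap_(l in [set l | (l < k)%N]) [set v : 'rV[R]_(k * k) | c <= entry v l l].
pose D := [set p : nat * (nat -> int) | (p.1 < k)%N /\ exists2 m, (m <= p.1)%N & p.2 m != 0].
pose C2 := \bigcap_(p in D) [set v : 'rV[R]_(k * k) |
  entry v p.1 p.1 ^+ 2 <= qform (entry v) (fun m => (p.2 m)%:~R) p.1.+1].
have cl1 : closed C1.
  apply: closed_bigI => l _; apply: closed_le_fun; first exact: cst_continuous.
  exact: entry_continuous.
have cl2 : closed C2.
  apply: closed_bigI => p _; apply: closed_le_fun; last exact: qform_continuous.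
  exact/continuous_sqr/entry_continuous.
rewrite (_ : mkset _ = B `&` (C1 `&` C2)).
  by apply: compact_closedI => //; apply: closedI.
apply/seteqP; split => v.
  move=> [vB vc Hv]; split; first by move=> i; rewrite in_itv /= vB.
  split; first by move=> l lk; exact: vc.
  by move=> [d z] [dk z0]; have [_] := Hv _ dk; apply.
move=> [vB [v1 v2]]; split; first by move=> i; have := vB i; rewrite in_itv.
  by move=> l lk; exact: v1.
move=> d dk; split; first by apply: lt_le_trans c0 _; exact: v1.
by move=> z z0; apply: (v2 (d, z)).
Qed.

(** The ratio is invariant under scaling and size reduction, so the entry of index [k.-1] may be set
    to 1. The identity has ratio 1, hence only ratios of at least 1 matter, and the assumed bound
    confines their bases to a compact set. *)
Lemma sqr_ratio_max k (s t : seq nat) : (0 < k)%N ->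
  all (fun i => i < k)%N s -> all (fun i => i < k)%N t -> size s = size t ->
  (exists M : R, forall x, (forall l, (l < k)%N -> 0 < x l) ->
    (forall i j, (j <= i < k)%N -> x i ^+ 2 <= 2 ^+ (i - j) * x j ^+ 2) ->
    x k.-1 = 1 -> 1 <= sqr_ratio s t x -> forall l, (l < k)%N -> x l <= M) ->
  exists2 a, HKZ_tri k a & forall a', HKZ_tri k a' ->
    sqr_ratio s t (fun l => a' l l) <= sqr_ratio s t (fun l => a l l).
Proof.
move=> k0 sk tk st [M0 HM]; pose M := Num.max 1 M0.
(* [HKZ_tri_diag] and the normalization give [1 <= 2 ^ k * x l ^ 2], whence [x l >= 2 ^ -k]. *)
pose c : R := (2 ^+ k)^-1.
have k1 : (k.-1 < k)%N by rewrite prednK.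
have p1 : 1 <= 2 ^+ k :> R by rewrite exprn_ege1 // ler1n.
have c0 : 0 < c by rewrite invr_gt0 (lt_le_trans ltr01).
pose A := [set v : 'rV[R]_(k * k) | [/\ forall i, - M <= v 0 i <= M,
     forall l, (l < k)%N -> c <= entry v l l & HKZ_tri k (entry v)]].
have Aval a : HKZ_tri k a -> 1 <= sqr_ratio s t (fun l => a l l) ->
    exists2 v, A v & sqr_ratio s t (fun l => entry v l l) = sqr_ratio s t (fun l => a l l).
  move=> Ha ge1; have [ak _] := Ha _ k1.
  have e0 : 0 < (a k.-1 k.-1)^-1 by rewrite invr_gt0.
  set e := (a k.-1 k.-1)^-1 in e0.
  have [a1 [Ha1 diag1 a10 a12]] := size_reduce (HKZ_tri_scale e0 Ha).
  have r1 : sqr_ratio s t (fun l => a1 l l) = sqr_ratio s t (fun l => a l l).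
    rewrite -[RHS](sqr_ratio_scale (c := e)) ?gt_eqF //.
    exact: eq_sqr_ratio sk tk diag1.
  have a1pos l : (l < k)%N -> 0 < a1 l l by move=> /Ha1[].
  have a1k : a1 k.-1 k.-1 = 1 by rewrite diag1 // /e mulVf // gt_eqF.
  have a1d i j : (j <= i < k)%N -> a1 i i ^+ 2 <= 2 ^+ (i - j) * a1 j j ^+ 2.
    exact: HKZ_tri_diag Ha1.
  have a1M l : (l < k)%N -> a1 l l <= M.
    move=> lk; rewrite /M le_max; apply/orP; right.
    by apply: (HM (fun l => a1 l l)) => //; rewrite r1.
  pose v := mxvec (\matrix_(i < k, j < k) a1 i j).
  have ev m l : (m < k)%N -> (l < k)%N -> entry v m l = a1 m l by exact: entry_mxvec.
  exists v; last by rewrite -r1; apply: eq_sqr_ratio sk tk _ => l lk; rewrite ev.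
  split.
  - move=> i; case/mxvec_indexP: i => i j; rewrite mxvecE mxE -ler_norml.
    have [ij|ji|->] := ltngtP i j; last by rewrite gtr0_norm ?a1pos ?a1M.
      apply: le_trans (a12 i j _) _; first by rewrite ij /=.
      rewrite -diag1 //; have := a1M j (ltn_ord j); have := a1pos j (ltn_ord j); lra.
    by rewrite a10 // normr0 /M le_max ler01.
  - move=> l lk; rewrite ev //.
    have /a1d : (l <= k.-1 < k)%N by rewrite k1 andbT -ltnS prednK.
    rewrite a1k expr1n => h; have al := a1pos _ lk.
    have h2 : 1 <= 2 ^+ k * a1 l l ^+ 2.
      apply: le_trans h _; rewrite ler_pM2r ?exprn_gt0 // ler_weXn2l ?ler1n //.
      by rewrite leq_subLR (leq_trans (leq_pred k)) // leq_addl.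
    rewrite -[leLHS]mulr1 ler_pdivrMl ?(lt_le_trans ltr01) //.
    rewrite leNgt; apply/negP => h3.
    have : (2 ^+ k * a1 l l) * (2 ^+ k * a1 l l) < 1.
      by rewrite -[ltRHS]mulr1 ltr_pM // ltW // mulr_gt0 // (lt_le_trans ltr01).
    by nra.
  - move=> d dk; rewrite ev //; have [? min] := Ha1 _ dk; split => // z z0.
    rewrite (@eq_qform _ _ a1) ?min // => l m ml ld.
    by rewrite ev // ?(leq_ltn_trans ml) // (leq_ltn_trans _ dk).
have id1 : sqr_ratio s t (fun l => (l == l)%:R) = 1 :> R.
  by rewrite /sqr_ratio !big1 ?divr1 // => i _; rewrite eqxx expr1n.
have [|v0 Av0 v0E] := Aval _ (@HKZ_tri_id k); first by rewrite id1.
have cA : compact A by exact: HKZ_tri_compact.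
pose f v := sqr_ratio s t (fun l => @entry k v l l).
have cf : {within A, continuous f}.
  have cprod (u : seq nat) :
      continuous (fun v : 'rV[R]_(k * k) => \prod_(i <- u) entry v i i ^+ 2).
    refine (@continuous_prod_sqr _ u (fun i (v : 'rV[R]_(k * k)) => entry v i i) _).
    by move=> i; exact: entry_continuous.
  apply: continuous_in_subspaceT => v /set_mem[_ vc _].
  apply: (continuous_div (cprod s) (cprod t)).
  rewrite prodf_seq_neq0; apply/allP => i it /=.
  by rewrite expf_neq0 // gt_eqF // (lt_le_trans c0) // vc // (allP tk).
have [v /set_mem Av vmax] := EVT_max_rV (ex_intro _ v0 Av0) cA cf.
exists (entry v); first by have [] := Av.
move=> a Ha; have [/ltW h|/(Aval _ Ha)[w Aw <-]] := ltP (sqr_ratio s t (fun l => a l l)) 1.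
  by apply: le_trans h _; rewrite -id1 -v0E; apply: vmax; exact: mem_set.
by apply: vmax; exact: mem_set.
Qed.

End MaximumAttained.

(** * Asymptotics *)

Section Asymptotics.
Variable R : realType.
Implicit Types (a : nat -> nat -> R) (F : nat -> R).

Lemma ln_bigprod (s : seq nat) (x : nat -> R) : (forall i, i \in s -> 0 < x i) ->
  0 < \prod_(i <- s) x i ^+ 2 /\
  ln (\prod_(i <- s) x i ^+ 2) = 2 * \sum_(i <- s) ln (x i).
Proof.
elim: s => [|i s IH] xs; first by rewrite !big_nil ln1 mulr0.
have xi : 0 < x i by apply: xs; rewrite mem_head.
have [|p0 pE] := IH; first by move=> j js; apply: xs; rewrite inE js orbT.
rewrite !big_cons mulr_gt0 ?exprn_gt0 //; split => //.
by rewrite lnM ?posrE ?exprn_gt0 // pE lnXn // mulrDr !mulr_natl.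
Qed.

Lemma ln_sqr_ratio (s t : seq nat) (x : nat -> R) : (forall i, i \in s -> 0 < x i) ->
  (forall i, i \in t -> 0 < x i) -> 0 < sqr_ratio s t x /\
  ln (sqr_ratio s t x) = 2 * (\sum_(i <- s) ln (x i) - \sum_(i <- t) ln (x i)).
Proof.
move=> /ln_bigprod[s0 sE] /ln_bigprod[t0 tE].
by rewrite /sqr_ratio divr_gt0 // ln_div ?posrE // sE tE mulrBr.
Qed.

Lemma HKZ_tri_ln k a : HKZ_tri k a -> forall l, (l < k)%N ->
  l.+1%:R * ln (a l l) <= l.+1%:R / 2 * ln l.+1%:R + \sum_(i < l.+1) ln (a i i).
Proof.
move=> Ha l lk; have apos i : (i < l.+1)%N -> 0 < a i i.
  by move=> il; have [] := Ha i (leq_trans il lk).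
have [al minl] := Ha l lk.
have := hermite (ltn0Sn l) (ltW al) apos (fun z z0 => minl z z0).
have sl : 0 < Num.sqrt l.+1%:R :> R by rewrite sqrtr_gt0.
have pl : 0 < \prod_(i < l.+1) a i i by apply: prodr_gt0 => i _; exact: apos.
rewrite -ler_ln ?posrE ?mulr_gt0 ?exprn_gt0 // lnM ?posrE ?exprn_gt0 //.
rewrite !lnXn // -powR12_sqrt // ln_powR.
rewrite -[ln (a l l) *+ _]mulr_natl -[(_ * _) *+ _]mulr_natl.
suff -> : ln (\prod_(i < l.+1) a i i) = \sum_(i < l.+1) ln (a i i).
  by rewrite mulrA.
elim: l.+1 apos {pl} => [|n IH] apos; first by rewrite !big_ord0 ln1.
have an : 0 < a n n by exact: apos.
have apos' i (ni : (i < n)%N) : 0 < a i i by apply: apos; exact: ltnW.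
rewrite !big_ord_recr /= lnM ?posrE ?IH //.
by apply: prodr_gt0 => i _; exact: apos'.
Qed.

Lemma mean1 F : mean F 1 = F 0%N.
Proof. by rewrite /mean big_ord1 divr1. Qed.

Lemma hlog1 : hlog R 1 = 0.
Proof. by rewrite /hlog ln1 expr0n mul0r. Qed.

Lemma ln_double k : (0 < k)%N -> ln (2 * k)%:R = ln 2 + ln k%:R :> R.
Proof. by move=> k0; rewrite natrM lnM // posrE ltr0n. Qed.

Lemma hlog_double k : (0 < k)%N ->
  hlog R (2 * k) - hlog R k = ln 2 * ln k%:R + ln 2 ^+ 2 / 2.
Proof. by move=> k0; rewrite /hlog ln_double //; field. Qed.

Lemma ln2_bounds : 1 / 2 <= ln (2 : R) <= 1.
Proof.
have := @ln_le_sub1 R 2 (ltr0n _ 2); have := @ln_le_sub1 R (1 / 2) ltac:(lra).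
by rewrite ln_div ?posrE // ln1 sub0r => h1 h2; apply/andP; split; lra.
Qed.

(** By Minkowski the logarithm of index [k.-1] is at most the mean plus [ln k / 2]; the logarithm of
    index 0 is the mean of one term. *)
Lemma alpha_upper k a : (0 < k)%N -> HKZ_tri k a ->
  2 * (ln (a k.-1 k.-1) - ln (a 0%N 0%N)) <=
  ln k%:R ^+ 2 / 2 + 5 / 2 * ln k%:R.
Proof.
case: k => // k _ Ha; pose F l := ln (a l l).
have HF := HKZ_tri_ln Ha; have := @mean_le R F k.+1 1 k.+1 HF isT isT (leqnn _).
rewrite mean1 hlog1 ln1 !subr0.
have : F k <= ln k.+1%:R / 2 + mean F k.+1.
  have k0 : 0 < k.+1%:R :> R by [].
  rewrite -(ler_pM2l k0) mulrDr [_ * mean _ _]mulrC /mean divfK ?gt_eqF //.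
  rewrite (_ : _ * (ln _ / 2) = k.+1%:R / 2 * ln k.+1%:R); [exact: HF|by field].
rewrite /hlog /= -/(F k) -/(F 0%N); lra.
Qed.

(** From [k] to [2 k], [hlog] grows by [ln 2 * ln k] up to a constant; 4 times half of it is the
    main term. *)
Lemma beta_upper k a : (0 < k)%N -> HKZ_tri (2 * k) a ->
  4 * (mean (fun l => ln (a l l)) (2 * k) - mean (fun l => ln (a l l)) k) <=
  2 * ln 2 * ln k%:R + 4.
Proof.
move=> k0 Ha; have HF := HKZ_tri_ln Ha.
have := mean_le HF k0 (leq_pmull k _) (leqnn _) => /(_ isT).
rewrite hlog_double // ln_double //; have /andP[h1 h2] := ln2_bounds.
have : ln (2 : R) ^+ 2 <= 1 by rewrite expr2; nra.
lra.
Qed.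

Let C : R := 1 + ln 180.

Let C0 : 0 <= C.
Proof. by have := @ln_nat_ge0 R 180; rewrite /C; lra. Qed.

Let P := log_profile R.

(** The telescoping of [mean_le] from below, with [log_profile_ge] in place of Minkowski's
    inequality. *)
Lemma log_profile_mean d e : (0 < d)%N -> (d <= e)%N ->
  (hlog R e - hlog R d) / 2 - (C + 1 / 2) * (ln e%:R - ln d%:R) <=
  mean P e - mean P d.
Proof.
move=> d0 de.
pose v n : R := hlog R n / 2 - (C + 1 / 2) * ln n%:R.
have : v e - v d <= mean P e - mean P d; last by rewrite /v; lra.
apply: telescope_le => // i di ie; have i0 : (0 < i)%N := leq_trans d0 di.
rewrite meanS //; have := log_profile_ge R i; rewrite -/C -/P.
have [+ _] := hlogS R i0; have /andP[+ _] := ln_natS_sub R i0; rewrite /v.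
have i0' : 0 < i%:R :> R by rewrite ltr0n.
have i1' : 0 < i.+1%:R :> R by rewrite ltr0n.
set S := \sum_(j < i) _; set L := ln i%:R; set L' := ln i.+1%:R => h1 h2 h3.
have : (L' / 2 - C) / i.+1%:R <= (i%:R * P i - S) / (i%:R * i.+1%:R).
  rewrite ler_pdivlMr ?mulr_gt0 //; apply: le_trans h3.
  rewrite le_eqVlt; apply/orP; left; apply/eqP; field.
  by rewrite gt_eqF.
apply: le_trans; rewrite mulrBl.
have : C * (i.+1%:R)^-1 <= C * (L' - L) by apply: ler_wpM2l.
move: h2; rewrite mulrAC; set X := L' / i.+1%:R; set Y := C / i.+1%:R.
rewrite -/(hlog R i.+1) (_ : L' / 2 / _ = X / 2); last by rewrite mulrAC.
lra.
Qed.

Lemma log_profile_alpha k : (2 <= k)%N ->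
  ln k%:R ^+ 2 / 2 - (6 * C + 1) * ln k%:R <= 2 * (P k.-1 - P 0%N).
Proof.
case: k => // k k1; have := @log_profile_mean 1 k.+1 isT isT.
have P0 : P 0%N = 0 by [].
rewrite mean1 P0 hlog1 ln1 !subr0 [_.-1]/=.
have : mean P k.+1 - C <= P k.
  have k0 : 0 < k.+1%:R :> R by [].
  have kk : k.+1%:R = k%:R + 1 :> R by rewrite natr1.
  rewrite lerBlDr /mean ler_pdivrMr // big_ord_recr /=.
  have := log_profile_ge R k; rewrite -/C -/P kk.
  have : 0 <= k%:R * ln k.+1%:R :> R by rewrite mulr_ge0 // ln_nat_ge0.
  have := C0; rewrite kk; set n := k%:R; set S := \sum_(i < k) _.
  nra.
(* This absorbs the additive constant [2 C] into [4 C] times the logarithm. *)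
have : 1 / 2 <= ln (k.+1%:R : R).
  have /andP[h _] := ln2_bounds; apply: le_trans h _.
  by rewrite ler_ln ?posrE // ler_nat.
have := C0; rewrite /hlog; set L := ln _ => h1 h2 h3 h4.
nra.
Qed.

Lemma log_profile_beta k : (0 < k)%N ->
  2 * ln 2 * ln k%:R - (4 * C + 2) <= 4 * (mean P (2 * k) - mean P k).
Proof.
move=> k0; have := log_profile_mean k0 (leq_pmull k _) => /(_ 2 isT).
rewrite hlog_double // ln_double //; have /andP[h1 h2] := ln2_bounds.
have : 0 <= ln (2 : R) ^+ 2 by exact: sqr_ge0.
have : (C + 1 / 2) * ln 2 <= C + 1 / 2 by rewrite ler_piMr //; have := C0; lra.
rewrite addrK; lra.
Qed.

Lemma log_profile_HKZ k : exists2 a, HKZ_tri k a &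
  forall l, (l < k)%N -> ln (a l l) = P l.
Proof.
have [|d|a Ha aP] := @exists_tri R k (fun l => expR (P l)).
- by move=> d; exact: expR_gt0.
- exact: log_profile_ratio.
by exists a => // l lk; rewrite aP // expRK.
Qed.

End Asymptotics.

(** * Schnorr's constants as maxima over triangular bases *)

Section Schnorr.
Variable R : realType.
Implicit Types (A : set R) (x : nat -> R).

Lemma maximum_eq A m : A m -> ubound A m -> maximum A = m.
Proof.
move=> Am mA; apply: xget_unique => // y [Ay yA].
by apply/eqP; rewrite eq_le mA // yA.
Qed.

(** [phi] receives the Gram-Schmidt norms from the last to the first, hence the index [k - l.+1]. *)
Lemma maximum_profile k (phi : (nat -> R) -> R) a :
  (forall x y, (forall l, (l < k)%N -> x l = y l) -> phi x = phi y) ->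
  HKZ_tri k a ->
  (forall a', HKZ_tri k a' -> phi (fun l => a' l l) <= phi (fun l => a l l)) ->
  maximum [set y | exists (n : nat) (b : seq 'rV[R]_n),
    HKZ_reduced_basis k b /\ y = phi (fun l => enorm (gso b)`_(k - l.+1))] =
  phi (fun l => a l l).
Proof.
move=> ext Ha amax; apply: maximum_eq.
  have [b [Hb bE]] := HKZ_of_tri Ha; exists k, b; split => //.
  by apply: ext => l lk; rewrite bE.
move=> _ [n [b [[sb _ /tri_of_HKZ[a' []]] + + _ ->]]]; rewrite sb => Ha' aE.
by rewrite (ext _ (fun l => a' l l)) ?amax // => l lk; rewrite aE.
Qed.

Lemma ler_of_sqr_le (y B : R) : 1 <= B -> y ^+ 2 <= B -> y <= B.
Proof. by move=> B1 yB; have [//|h] := lerP y B; nra. Qed.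

(** The other factors contribute at most [B ^ k]. *)
Lemma mulr_ler_of_le_prod (r : nat -> R) (B : R) k l : (l < k)%N -> 1 <= B ->
  (forall i, (i < k)%N -> 0 <= r i <= B) -> 1 <= \prod_(i < k) r i ->
  1 <= r l * B ^+ k.
Proof.
move=> lk B1 rB; rewrite (bigD1 (Ordinal lk)) //= => /le_trans; apply.
have /andP[r0 _] := rB l lk; apply: ler_wpM2l => //.
apply: (@le_trans _ _ (\prod_(i < k | i != Ordinal lk) B)).
  by apply: ler_prod => i _; exact: rB.
by rewrite prodr_const ler_weXn2l // (leq_trans (max_card _)) // card_ord.
Qed.

Lemma schnorr_alphaE k : (2 <= k)%N -> exists a, [/\ HKZ_tri k a,
  schnorr_alpha R k = sqr_ratio [:: k.-1] [:: 0%N] (fun l => a l l) &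
  forall a', HKZ_tri k a' ->
    sqr_ratio [:: k.-1] [:: 0%N] (fun l => a' l l) <= schnorr_alpha R k].
Proof.
move=> k2; have k0 : (0 < k)%N by exact: ltnW.
have sk : all (fun i => i < k)%N [:: k.-1] by rewrite /= prednK // leqnn.
have tk : all (fun i => i < k)%N [:: 0%N] by rewrite /= k0.
have [|a Ha amax] := @sqr_ratio_max R k [:: k.-1] [:: 0%N] k0 sk tk erefl.
  (* A ratio of at least 1 means [x 0 <= 1] here, and [x l ^ 2 <= 2 ^ l * x 0 ^ 2]. *)
  exists (2 ^+ k) => x xpos xd xk; rewrite /sqr_ratio !big_seq1 xk expr1n div1r.
  rewrite invf_ge1 ?exprn_gt0 ?xpos // => x0 l lk.
  have x2 : x l ^+ 2 <= 2 ^+ k.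
    apply: le_trans (xd l 0%N _) _; first by rewrite lk.
    rewrite subn0; apply: (@le_trans _ _ (2 ^+ l)); first by rewrite ler_piMr // exprn_ge0.
    by rewrite ler_weXn2l ?ler1n // ltnW.
  have p1 : 1 <= 2 ^+ k :> R by rewrite exprn_ege1 // ler1n.
  exact: ler_of_sqr_le.
have aE : schnorr_alpha R k = sqr_ratio [:: k.-1] [:: 0%N] (fun l => a l l).
  rewrite -(maximum_profile (phi := sqr_ratio [:: k.-1] [:: 0%N]) _ Ha amax); last first.
    by move=> x y; exact: eq_sqr_ratio.
  congr maximum; apply/seteqP; split => y [n [b [Hb ->]]]; exists n, b; split => //;
    have [sb _ _] := Hb; rewrite /sqr_ratio !big_seq1 prednK // subnn subn1;
    by case: (b) sb k0 => [<-//|u s _ _]; rewrite gso_cons.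
by exists a; split => // a' Ha'; rewrite aE amax.
Qed.

Lemma schnorr_betaE k : (2 <= k)%N ->
  let V (a : nat -> nat -> R) :=
    sqr_ratio (index_iota k (2 * k)) (index_iota 0 k) (fun l => a l l) `^ k%:R^-1 in
  exists a, [/\ HKZ_tri (2 * k) a, schnorr_beta R k = V a &
    forall a', HKZ_tri (2 * k) a' -> V a' <= schnorr_beta R k].
Proof.
move=> k2 V; have k0 : (0 < k)%N by exact: ltnW.
set s := index_iota k _ in V *; set t := index_iota 0 k in V *.
have kk : (2 * k - k = k)%N by rewrite mul2n -addnn addnK.
have sk : all (fun i => i < 2 * k)%N s by apply/allP => i; rewrite mem_index_iota => /andP[].
have tk : all (fun i => i < 2 * k)%N t.
  by apply/allP => i; rewrite mem_index_iota /= => /leq_trans; apply; rewrite leq_pmull.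
have k20 : (0 < 2 * k)%N by rewrite muln_gt0.
have st : size s = size t by rewrite !size_iota kk subn0.
have ratioE x : sqr_ratio s t x = \prod_(l < k) (x (l + k)%N ^+ 2 / x l ^+ 2).
  rewrite /sqr_ratio /s /t -{1}[k]add0n big_addn kk !big_mkord.
  by rewrite -prodfV -big_split.
have [|a Ha amax] := @sqr_ratio_max R (2 * k) s t k20 sk tk st.
  (* The ratio is a product of [k] quotients [x (l + k) ^ 2 / x l ^ 2], each at most [2 ^ k]; as it
     is at least 1, none is less than [2 ^ -(k * k)]. From [x (2 k - 1) = 1] this bounds
     [x (k - 1)], then the entries of larger index, then those of smaller index. *)
  pose B : R := 2 ^+ (k * k + (2 * k + k * k)).
  exists B => x xpos xd xk; rewrite ratioE => ge1.
  have p1 n : 1 <= 2 ^+ n :> R by rewrite exprn_ege1 // ler1n.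
  have p0 n : 0 < 2 ^+ n :> R by exact: lt_le_trans (p1 n).
  have x20 l : (l < 2 * k)%N -> 0 < x l ^+ 2 by move=> /xpos; exact: exprn_gt0.
  have pair l : (l < k)%N -> x l ^+ 2 <= 2 ^+ (k * k) * x (l + k)%N ^+ 2.
    move=> lk; have lk2 : (l < 2 * k)%N by lia.
    have rB i : (i < k)%N -> 0 <= x (i + k)%N ^+ 2 / x i ^+ 2 <= 2 ^+ k.
      move=> ik; have ik2 : (i < 2 * k)%N by lia.
      rewrite divr_ge0 ?sqr_ge0 //= ler_pdivrMr ?x20 //.
      by have := xd (i + k)%N i; rewrite addKn; apply; lia.
    have := @mulr_ler_of_le_prod (fun i => x (i + k)%N ^+ 2 / x i ^+ 2) _ _ _ lk (p1 k) rB ge1.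
    by rewrite /= -exprM mulrAC ler_pdivlMr ?x20 // mul1r mulrC.
  have top l : (k.-1 <= l < 2 * k)%N -> x l ^+ 2 <= 2 ^+ (2 * k + k * k).
    move=> /[dup] klk /xd /le_trans; apply; rewrite exprD.
    apply: ler_pM; rewrite ?sqr_ge0 ?(ltW (p0 _)) //.
      by rewrite ler_weXn2l ?ler1n //; lia.
    have := pair k.-1; rewrite (_ : (k.-1 + k)%N = (2 * k).-1) ?xk ?expr1n ?mulr1; last by lia.
    by apply; lia.
  move=> l lk; have : x l ^+ 2 <= B.
    have [kl|kl] := leqP k.-1 l.
      apply: le_trans (top l _) _; first by rewrite kl.
      by rewrite ler_weXn2l ?ler1n // leq_addl.
    apply: le_trans (pair l _) _; first lia.
    by rewrite /B exprD ler_pM2l // top //; lia.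
  have := p1 (k * k + (2 * k + k * k))%N; rewrite -/B.
  exact: ler_of_sqr_le.
pose phi x := sqr_ratio s t x `^ k%:R^-1.
have ratio0 x : 0 <= sqr_ratio s t x.
  by rewrite ratioE; apply: prodr_ge0 => i _; rewrite divr_ge0 ?sqr_ge0.
have Vmax a' : HKZ_tri (2 * k) a' -> phi (fun l => a' l l) <= phi (fun l => a l l).
  by move=> Ha'; apply: ge0_ler_powR; rewrite ?nnegrE ?ratio0 ?amax ?invr_ge0.
have aE : schnorr_beta R k = V a.
  rewrite -[RHS]/(phi (fun l => a l l)) -(maximum_profile (phi := phi) _ Ha Vmax); last first.
    by move=> x y xy; rewrite /phi (eq_sqr_ratio sk tk xy).
  (* The reversed numbering exchanges the two halves and reverses each of them. *)
  have pE (x : nat -> R) : phi (fun l => x (2 * k - l.+1)%N) =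
      ((\prod_(0 <= i < k) x i ^+ 2) / (\prod_(k <= i < 2 * k) x i ^+ 2)) `^ k%:R^-1.
    have shift (G : nat -> R) :
        \prod_(k <= i < 2 * k) G i = \prod_(0 <= i < k) G (i + k)%N.
      by rewrite -{1}[k]add0n big_addn kk.
    rewrite /phi /sqr_ratio /s /t; congr ((_ / _) `^ _).
      rewrite [LHS]big_nat_rev shift; apply: eq_big_nat => i /andP[_ ik].
      by congr (x _ ^+ 2); lia.
    rewrite [RHS]big_nat_rev shift; apply: eq_big_nat => i /andP[_ ik].
    by congr (x _ ^+ 2); lia.
  congr maximum; apply/seteqP; split => y [n [b [Hb ->]]]; exists n, b; split => //;
    by rewrite (pE (fun i => enorm (gso b)`_i)).
by exists a; split => // a' Ha'; rewrite aE; exact: Vmax.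
Qed.

Lemma powR_error (y g K : R) (n : nat) : (2 <= n)%N -> 0 < y ->
  `|ln y - g * ln n%:R| <= K ->
  `|ln y / ln n%:R - g| <= K / ln n%:R /\
  y = n%:R `^ (g + (ln y / ln n%:R - g)).
Proof.
move=> n2 y0 h; have n0 : 0 < n%:R :> R by rewrite ltr0n ltnW.
have l0 : 0 < ln (n%:R : R) by rewrite ln_gt0 // ltr1n.
split.
  rewrite ler_pdivlMr // -[X in _ * X]gtr0_norm // -normrM mulrBl divfK ?gt_eqF //.
by rewrite addrC subrK /powR gt_eqF // divfK ?gt_eqF // lnK.
Qed.

End Schnorr.

Theorem theorem5 (R : realType) :
  (exists e : nat -> R,
     (exists C : R, forall k : nat, (2 <= k)%N -> `|e k| <= C) /\
     (forall k : nat, (2 <= k)%N ->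
        schnorr_alpha R k = k%:R `^ (ln k%:R / 2 + e k))) /\
  (exists e : nat -> R,
     (exists C : R, forall k : nat, (2 <= k)%N -> `|e k| <= C * (1 / ln k%:R)) /\
     (forall k : nat, (2 <= k)%N ->
        schnorr_beta R k = k%:R `^ (2 * ln 2 + e k))).
Proof.
pose c : R := 1 + ln 180.
have c0 : 0 <= c by have := @ln_nat_ge0 R 180; rewrite /c; lra.
split.
  pose K := 6 * c + 5.
  have main k : (2 <= k)%N -> 0 < schnorr_alpha R k /\
      `|ln (schnorr_alpha R k) - ln k%:R / 2 * ln k%:R| <= K * ln k%:R.
    move=> k2; have k0 : (0 < k)%N by exact: ltnW.
    have k1 : (k.-1 < k)%N by rewrite prednK.
    have [a [Ha aE amax]] := schnorr_alphaE R k2.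
    have lnE (a' : nat -> nat -> R) : HKZ_tri k a' ->
        0 < sqr_ratio [:: k.-1] [:: 0%N] (fun l => a' l l) /\
        ln (sqr_ratio [:: k.-1] [:: 0%N] (fun l => a' l l)) =
        2 * (ln (a' k.-1 k.-1) - ln (a' 0%N 0%N)).
      move=> Ha'; have := @ln_sqr_ratio R [:: k.-1] [:: 0%N] (fun l => a' l l).
      rewrite !big_seq1; apply => i; rewrite inE => /eqP->.
        by have [] := Ha' _ k1.
      by have [] := Ha' _ k0.
    have [pos lnaE] := lnE a Ha; rewrite aE; split => //.
    (* The lower bound compares the maximum with its value on the constructed profile. *)
    have [p Hp pE] := log_profile_HKZ R k; have [ppos lnpE] := lnE p Hp.
    have up := alpha_upper k0 Ha; have low := log_profile_alpha R k2.
    have := amax p Hp; rewrite aE -ler_ln ?posrE // lnpE !pE // => pa.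
    have L0 := ln_nat_ge0 R k; rewrite lnaE in pa *; rewrite -/c in low.
    have cL : 0 <= c * ln k%:R by rewrite mulr_ge0.
    by rewrite ler_norml /K; apply/andP; split; nra.
  exists (fun k => ln (schnorr_alpha R k) / ln k%:R - ln k%:R / 2); split.
    exists K => k k2; have [pos h] := main k k2.
    have [+ _] := powR_error k2 pos h.
    by rewrite mulfK // gt_eqF // ln_gt0 // ltr1n.
  by move=> k k2; have [pos h] := main k k2; have [_] := powR_error k2 pos h.
pose K := 4 * c + 4.
have main k : (2 <= k)%N -> 0 < schnorr_beta R k /\
    `|ln (schnorr_beta R k) - 2 * ln 2 * ln k%:R| <= K.
  move=> k2; have k0 : (0 < k)%N by exact: ltnW.
  have [a [Ha aE amax]] := schnorr_betaE R k2.
  have lnE (a' : nat -> nat -> R) : HKZ_tri (2 * k) a' ->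
      let V := sqr_ratio (index_iota k (2 * k)) (index_iota 0 k) (fun l => a' l l) `^ k%:R^-1 in
      0 < V /\ ln V =
      4 * (mean (fun l => ln (a' l l)) (2 * k) - mean (fun l => ln (a' l l)) k).
    move=> Ha' V; have apos l : (l < 2 * k)%N -> 0 < a' l l by move=> /Ha'[].
    have [||pos lnr] := @ln_sqr_ratio R (index_iota k (2 * k)) (index_iota 0 k) (fun l => a' l l).
    - by move=> i; rewrite mem_index_iota => /andP[_]; exact: apos.
    - by move=> i; rewrite mem_index_iota => /= ik; apply: apos; lia.
    rewrite /V powR_gt0 // ln_powR lnr; split => //.
    (* The sum over the indices from [k] on is [2 k] times one mean minus [k] times the other; this
       yields 4 times the difference of the means. *)
    rewrite /mean -!(big_mkord predT (fun l => ln (a' l l))).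
    rewrite [\sum_(0 <= i < 2 * k) _](big_cat_nat (n := k)) ?leq_pmull //=.
    by rewrite natrM; field; rewrite pnatr_eq0 -lt0n k0.
  have [pos lnaE] := lnE a Ha; rewrite aE; split => //.
  have [p Hp pE] := log_profile_HKZ R (2 * k); have [ppos lnpE] := lnE p Hp.
  have up := beta_upper k0 Ha; have low := log_profile_beta R k0.
  have meanE d : (d <= 2 * k)%N -> mean (fun l => ln (p l l)) d = mean (log_profile R) d.
    move=> dk; congr (_ / _); apply: eq_bigr => i _.
    by rewrite pE // (leq_trans (ltn_ord i)).
  have := amax p Hp; rewrite aE -ler_ln ?posrE // lnpE !meanE ?leq_pmull // => pa.
  rewrite lnaE in pa *; rewrite -/c in low.
  by rewrite ler_norml /K; apply/andP; split; lra.
exists (fun k => ln (schnorr_beta R k) / ln k%:R - 2 * ln 2); split.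
  exists K => k k2; have [pos h] := main k k2.
  by have [+ _] := powR_error k2 pos h; rewrite div1r.
by move=> k k2; have [pos h] := main k k2; have [_] := powR_error k2 pos h.
Qed.
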